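(* Let $n\ge 2$. Among all octagonal chains with $n$ octagons, the helicene octagonal chain $D_n=O(\underbrace{0,0,\ldots,0}_{n-2})$ is the unique chain (up to graph isomorphism) with minimum Kirchhoff index; that is, every octagonal chain $O(w)$, $w\in\{0,1,2,3,4\}^{n-2}$, satisfies $Kf(O(w))\ge Kf(D_n)$, with equality only if $O(w)$ is isomorphic to $D_n$.
   Context: Resistance distance and Kirchhoff index: for a finite simple connected graph $G$, the resistance distance $r_G(u,v)$ between vertices $u,v$ is the effective resistance between $u$ and $v$ in the electrical network obtained from $G$ by replacing each edge with a unit resistor. The Kirchhoff index is $Kf(G)=\sum_{\{u,v\}\subseteq V(G)} r_G(u,v)$, the sum over all unordered pairs of distinct vertices. Octagonal chains: for $n\ge 2$ let $Q_n$ be the ladder graph with $n$ squares, with top vertices $a_0,a_1,\ldots,a_n$, bottom vertices $c_0,c_1,\ldots,c_n$, rungs $a_jc_j$ ($0\le j\le n$), top edges $a_{j-1}a_j$ and bottom edges $c_{j-1}c_j$ ($1\le j\le n$). Its $j$-th square $S_j$ has vertices $a_{j-1},a_j,c_j,c_{j-1}$. An octagonal chain with $n$ octagons is obtained from $Q_n$ by adding four new vertices to each square: for each $j$, the top edge of $S_j$ is subdivided by some number $k\in\{0,1,2,3,4\}$ of new vertices and the bottom edge of $S_j$ is subdivided by the remaining $4-k$ new vertices, so that $S_j$ becomes an octagon. By convention, in $S_1$ and $S_n$ all four new vertices are put on the bottom edge. For a vector $w=(w_1,\ldots,w_{n-2})$ with entries in $\{0,1,2,3,4\}$, $O(w)$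 denotes the octagonal chain with $n$ octagons in which, for $1\le i\le n-2$, exactly $w_i$ new vertices are put on the top edge of $S_{i+1}$ and $4-w_i$ on its bottom edge. Every octagonal chain with $n$ octagons is represented as $O(w)$ for some such $w$ (up to isomorphism; for $n=2$ the vector is empty). *)

(* Defs.v *)
From HB Require Import structures.
From mathcomp Require Import all_boot all_order all_algebra.
From mathcomp Require Import classical_sets.

Set Implicit Arguments.
Unset Strict Implicit.
Unset Printing Implicit Defensive.

Import Order.TTheory GRing.Theory Num.Theory.
Local Open Scope ring_scope.

Record sgraph := SGraph {
  vertex :> finType;
  adj : rel vertex;
  adj_sym : symmetric adj;
  adj_irrefl : irreflexive adj }.

Definition sg_connected (G : sgraph) : Prop :=
  forall x y : G, connect (@adj G) x y.

Definition isomorphic (G H : sgraph) : Prop :=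
  exists2 f : G -> H, bijective f & forall x y, adj (f x) (f y) = adj x y.

(* Kirchhoff's current law in the network with unit resistors: by Ohm's law
   the current from x to a neighbour y is phi x - phi y, and a unit current
   enters at u and leaves at v. *)
Definition unit_potential (R : realFieldType) (G : sgraph) (u v : G)
    (phi : {ffun G -> R}) : Prop :=
  forall x : G,
    \sum_(y : G | adj x y) (phi x - phi y) = (x == u)%:R - (x == v)%:R.

(* The voltage between u and v for any unit potential. On a connected graph
   the choice made by [xget] is immaterial: see [resistanceE] and
   [unit_potential_ex] below. *)
Definition resistance (R : realFieldType) (G : sgraph) (u v : G) : R :=
  let phi := xget 0 [set phi : {ffun G -> R} | unit_potential u v phi]%classic
  in phi u - phi v.

Section ResistanceTheory.
Variables (R : realFieldType) (G : sgraph).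
Hypothesis Gconn : sg_connected G.

Let lap (d : G -> R) (x : G) : R := \sum_(y : G | adj x y) (d x - d y).

Let harmonic_const (d : G -> R) :
  (forall x, lap d x = 0) -> forall x y, d x = d y.
Proof.
move=> d0 x y; pose z := [arg max_(i > x) d i]%O.
have zmax i : d i <= d z by rewrite /z; case: arg_maxP => // k _; apply.
suff E i : connect (@adj G) z i -> d i = d z by rewrite !E //; apply: Gconn.
case/connectP=> p; elim/last_ind: p i => [|p a IH] i /=; first by move=> _ ->.
rewrite rcons_path last_rcons => /andP[pp ea] ->.
have dl := IH _ pp erefl; apply/esym/eqP; rewrite -subr_eq0 -dl; apply/eqP.
move: (d0 (last z p)) => /psumr_eq0P; apply=> // k _.
by rewrite dl subr_ge0.
Qed.

Lemma resistanceE (u v : G) (phi : {ffun G -> R}) :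
  unit_potential u v phi -> resistance R u v = phi u - phi v.
Proof.
move=> hphi; rewrite /resistance; case: xgetP => [psi _ /= hpsi|/(_ phi)//].
have /(_ u v) : forall x y, psi x - phi x = psi y - phi y.
  apply: (harmonic_const (d := fun x => psi x - phi x)) => x.
  transitivity (lap psi x - lap phi x); last first.
    by rewrite /lap hpsi hphi subrr.
  by rewrite -sumrB; apply: eq_bigr => y _; rewrite !opprD !opprK addrACA.
move=> e; have -> : psi u = phi u + (psi v - phi v) by rewrite -e addrC subrK.
by rewrite addrA addrAC addrK.
Qed.

Let lap_sum (d : G -> R) : \sum_x lap d x = 0.
Proof.
rewrite /lap (eq_bigr _ (fun x _ => sumrB _ _ _ _)) sumrB.
rewrite [X in _ - X](exchange_big_dep predT) //=.
apply/eqP; rewrite subr_eq0; apply/eqP/eq_bigr => x _.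
by apply: eq_bigl => y; rewrite adj_sym.
Qed.

Let tot (d : G -> R) : R := \sum_x d x.

Let L (d : {ffun G -> R^o}) : {ffun G -> R^o} :=
  [ffun x => lap d x + tot d].

Let L_linear : linear L.
Proof.
move=> a d e; apply/ffunP => x; rewrite !ffunE /lap /tot scalerDr.
rewrite !scaler_sumr addrACA -!big_split /=; congr (_ + _).
  by apply: eq_bigr => y _; rewrite !ffunE scalerBr opprD addrACA.
by apply: eq_bigr => y _; rewrite !ffunE.
Qed.

Let L_sum (d : {ffun G -> R^o}) : tot (L d) = tot d *+ #|G|.
Proof.
transitivity (\sum_x (lap d x + tot d)).
  by apply: eq_bigr => x _; rewrite ffunE.
by rewrite big_split /= lap_sum add0r; apply: sumr_const.
Qed.

Lemma unit_potential_ex (u v : G) :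
  exists phi : {ffun G -> R}, unit_potential u v phi.
Proof.
have Gn0 : #|G| != 0%N by apply/eqP=> /card0_eq /(_ u).
have sum0 (d : {ffun G -> R^o}) : tot (L d) = 0 -> tot d = 0.
  by move/eqP; rewrite L_sum mulrn_eq0 (negPf Gn0) /= => /eqP.
pose Ll : {linear {ffun G -> R^o} -> {ffun G -> R^o}} :=
  HB.pack L (GRing.isLinear.Build _ _ _ _ L L_linear).
have kerL : lker (linfun Ll) == 0%VS.
  apply/lker0P => d e; rewrite !lfunE => /eqP.
  rewrite -subr_eq0 -raddfB /=; set f := d - e => /eqP Lf.
  have sf : tot f = 0.
    by apply: sum0; rewrite Lf /tot big1 // => x _; rewrite ffunE.
  have f_const : forall x y, f x = f y.
    apply: harmonic_const => x.
    by move/ffunP: Lf => /(_ x); rewrite !ffunE sf addr0.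
  apply/eqP; rewrite -subr_eq0 -/f; apply/eqP/ffunP => x; rewrite [RHS]ffunE.
  move: sf; rewrite /tot (eq_bigr _ (fun y _ => f_const y x)) sumr_const.
  by move/eqP; rewrite mulrn_eq0 (negPf Gn0) /= => /eqP.
pose b := [ffun x : G => (x == u)%:R - (x == v)%:R] : {ffun G -> R^o}.
have [phi hb] : exists phi, b = L phi.
  by exists ((linfun Ll)^-1%VF b); rewrite -[RHS](lfunE Ll) lker0_lfunVK.
exists phi => x.
have sphi : tot phi = 0.
  have delta (w : G) : \sum_x (x == w)%:R = 1 :> R.
    by rewrite (bigD1 w) //= eqxx big1 ?addr0 // => k /negPf->.
  by apply: sum0; rewrite -hb /tot (eq_bigr _ (fun x _ => ffunE _ x)) sumrB !delta subrr.
by move/ffunP: hb => /(_ x); rewrite !ffunE sphi addr0 => ->.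
Qed.

End ResistanceTheory.

(* Each unordered pair of distinct vertices is counted once, listed in the
   order of the enumeration of the vertices. *)
Definition Kirchhoff_index (R : realFieldType) (G : sgraph) : R :=
  \sum_(u : G) \sum_(v : G | (enum_rank u < enum_rank v)%N) resistance R u v.

(* [inl (i, true)] is the top vertex a_i and [inl (i, false)] the bottom vertex
   c_i of the ladder; [inr (j, k)] is the k-th new vertex of the square with
   top vertices a_j, a_(j+1) (squares are numbered from 0). *)
Definition chain_vertex (n : nat) : finType :=
  ('I_n.+1 * bool + 'I_n * 'I_4)%type.

Section Chain.
Variables (n : nat) (t : 'I_n -> 'I_5).

(* The subdivided top (b = true) or bottom (b = false) edge of square j: its
   first [t j] new vertices are on the top edge, the others on the bottom. *)
Definition side_path (j : 'I_n) (b : bool) : seq (chain_vertex n) :=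
  inl (widen_ord (leqnSn n) j, b)
    :: rcons [seq inr (j, k) | k : 'I_4 <- enum 'I_4 & (k < t j)%N == b]
             (inl (lift ord0 j, b)).

Definition chain_step (x y : chain_vertex n) : bool :=
  [exists i : 'I_n.+1, (x == inl (i, true)) && (y == inl (i, false))]
  || [exists j : 'I_n, exists b : bool, infix [:: x; y] (side_path j b)].

Definition chain_adj : rel (chain_vertex n) :=
  fun x y => chain_step x y || chain_step y x.

Lemma chain_adj_sym : symmetric chain_adj.
Proof. by move=> x y; rewrite /chain_adj orbC. Qed.

Lemma side_path_uniq j b : uniq (side_path j b).
Proof.
rewrite /side_path /= mem_rcons inE negb_or rcons_uniq.
have inlF z : inl z \notin
    [seq (inr (j, k) : chain_vertex n) | k : 'I_4 <- enum 'I_4 & (k < t j)%N == b].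
  by apply/mapP => -[].
rewrite !inlF map_inj_uniq; last by move=> k l [].
rewrite filter_uniq ?enum_uniq //= !andbT.
by apply/eqP => -[/(@n_Sn j)].
Qed.

Lemma chain_adj_irrefl : irreflexive chain_adj.
Proof.
move=> x; rewrite /chain_adj orbb; apply/negP => /orP[].
  by case/existsP=> i /andP[/eqP-> /eqP].
case/existsP=> j /existsP[b] /infix_uniq /(_ (side_path_uniq j b)).
by rewrite /= inE eqxx.
Qed.

Definition chain : sgraph := SGraph chain_adj_sym chain_adj_irrefl.

Let side_path_connect j b x y :
  x \in side_path j b -> y \in side_path j b -> connect (@adj chain) x y.
Proof.
have csym : connect_sym (@adj chain) by apply: sym_connect_sym chain_adj_sym.
suff from_head z : z \in side_path j b ->
    connect (@adj chain) (inl (widen_ord (leqnSn n) j, b)) z.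
  by move=> /from_head hx /from_head; apply: connect_trans; rewrite csym.
have path_infix (p : seq (chain_vertex n)) : forall h, infix (h :: p) (side_path j b) ->
    path (@adj chain) h p.
  elim: p => // k p IH h hs; apply/andP; split.
    apply/orP; left; apply/orP; right; apply/existsP; exists j.
    apply/existsP; exists b; apply: infix_trans hs.
    exact: (prefix_infix [:: h; k] p).
  by apply: IH; apply: infix_trans hs; apply: (suffix_infix [:: h]).
by apply: path_connect; apply: path_infix; apply: infix_refl.
Qed.

Lemma chain_connected : sg_connected chain.
Proof.
have csym : connect_sym (@adj chain) by apply: sym_connect_sym chain_adj_sym.
pose h : chain := inl (ord0, true).
suff from_h z : connect (@adj chain) h z.
  by move=> x y; apply: connect_trans (from_h y); rewrite csym.
have rung (i : 'I_n.+1) : connect (@adj chain) (inl (i, true)) (inl (i, false)).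
  apply/connect1/orP; left; apply/orP; left.
  by apply/existsP; exists i; rewrite !eqxx.
have ladder i b (lt_i : (i < n.+1)%N) :
    connect (@adj chain) h (inl (Ordinal lt_i, b)).
  elim: i lt_i => [|i IH] lt_i.
    have -> : Ordinal lt_i = ord0 by apply/val_inj.
    by case: b; [apply: connect0|apply: rung].
  apply: connect_trans (IH (ltnW lt_i)) _.
  apply: (side_path_connect (j := Ordinal (lt_i : (i < n)%N)) (b := b)).
    by rewrite inE; apply/orP; left; apply/eqP; congr (inl (_, _)); apply/val_inj.
  rewrite inE mem_rcons inE; apply/orP; right; apply/orP; left.
  by apply/eqP; congr (inl (_, _)); apply/val_inj.
case: z => [[[i lt_i] b]|[j k]]; first exact: ladder.
apply: connect_trans (ladder j (k < t j)%N (ltnW (ltn_ord j) : (j < n.+1)%N)) _.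
apply: (side_path_connect (j := j) (b := (k < t j)%N)).
  by rewrite inE; apply/orP; left; apply/eqP; congr (inl (_, _)); apply/val_inj.
rewrite inE mem_rcons inE (map_f (fun k => inr (j, k) : chain_vertex n)) ?orbT //.
by rewrite mem_filter eqxx mem_enum.
Qed.

End Chain.

(* Squares 0 and n - 1 have no new vertex on top; square i + 1 has w_i. *)
Definition octagonal_chain (n : nat) (w : n.-2.-tuple 'I_5) : sgraph :=
  chain (fun j : 'I_n => nth ord0 (ord0 :: rcons w ord0) j).

Definition helicene (n : nat) : sgraph :=
  octagonal_chain [tuple (ord0 : 'I_5) | _ < n.-2].

(* Main.v *)
(** Each octagon of a chain is a cycle of 8 vertices, and the octagons form a
    basis of the cycle space whose Gram matrix (8 on the diagonal, -1 between
    neighbours) does not depend on the chain. The resistance of [u, v] is the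
    squared norm of any unit flow from [u] to [v], minus the squared norm of its
    projection on the cycle space. With flows that split evenly over the two
    sides of the octagons which they cross, the chain enters only through the
    offsets [x_j = w_j - 2], linearly in the circulation of a flow around
    octagon [j]. Summing over all pairs, the Kirchhoff index is
    [c - \sum_(i, j) a_ij x_i x_j], where [c] and [a_ij] depend only on the number
    of octagons and [a_ij > 0] unless [i] or [j] is terminal. As [|x_j| <= 2], the
    minimum is attained exactly when all inner [x_j] are equal to a common value
    -2 or 2, and reflecting every octagon exchanges these two chains. *)

Require Import Defs.
From mathcomp Require Import all_boot all_order all_algebra.
From mathcomp Require Import ring lra zify.

Set Implicit Arguments.
Unset Strict Implicit.
Unset Printing Implicit Defensive.

Import Order.TTheory GRing.Theory Num.Theory.
Local Open Scope ring_scope.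

(** * Resistances from flows and cycles *)

Lemma sum_indicator (R : pzSemiRingType) (I : finType) (i : I) (F : I -> R) :
  \sum_j (i == j)%:R * F j = F i.
Proof.
rewrite (bigD1 i) //= eqxx mul1r big1 ?addr0 // => j /negPf.
by rewrite eq_sym => ->; rewrite mul0r.
Qed.

Section GreenFunction.
Variables (R : realFieldType) (G : sgraph).
Hypothesis Gconn : sg_connected G.

(* [Phi u] is the potential of a unit current from [u] to the fixed
   distribution [p]; in [Phi u - Phi v] the distribution cancels. *)
Lemma Kirchhoff_index_green (p : G -> R) (Phi : G -> G -> R) :
  (forall u x, \sum_(y | adj x y) (Phi u x - Phi u y) = (x == u)%:R - p x) ->
  Kirchhoff_index R G =
    #|G|%:R * (\sum_u Phi u u) - \sum_u \sum_v Phi u v.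
Proof.
move=> green.
have resE u v : resistance R u v = Phi u u - Phi v u - Phi u v + Phi v v.
  rewrite (resistanceE Gconn (phi := [ffun x => Phi u x - Phi v x])).
    by rewrite !ffunE; ring.
  move=> x; transitivity (((x == u)%:R - p x) - ((x == v)%:R - p x)); last ring.
  by rewrite -!green -sumrB; apply: eq_bigr => y _; rewrite !ffunE; ring.
have res_sym (u v : G) : resistance R u v = resistance R v u by rewrite !resE; ring.
have half : Kirchhoff_index R G *+ 2 = \sum_(u : G) \sum_(v : G) resistance R u v.
  rewrite mulr2n {2}/Kirchhoff_index (exchange_big_dep predT) //=.
  rewrite -big_split /=; apply: eq_bigr => u _.
  rewrite [RHS](bigID (fun v => enum_rank u < enum_rank v)%N) /=; congr (_ + _).
  rewrite [RHS](bigD1 u) ?ltnn //= (_ : resistance R u u = 0); last by rewrite resE; ring.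
  rewrite add0r; apply: eq_big => [v|v _]; last by rewrite res_sym.
  by rewrite -leqNgt ltn_neqAle (inj_eq val_inj) (inj_eq enum_rank_inj) andbC.
apply: (mulIf (x := 2%:R)); first by rewrite pnatr_eq0.
rewrite mulr_natr half.
have sumC (F : G -> R) : \sum_u \sum_(v : G) F u = #|G|%:R * \sum_u F u.
  by rewrite mulr_sumr; apply: eq_bigr => u _; rewrite sumr_const mulr_natl.
transitivity (\sum_u \sum_(v : G) Phi u u + \sum_(u : G) \sum_v Phi v v
  - \sum_u \sum_v Phi u v - \sum_u \sum_v Phi v u).
  rewrite -big_split -!sumrB; apply: eq_bigr => u _ /=.
  by rewrite -big_split -!sumrB; apply: eq_bigr => v _ /=; rewrite resE; ring.
rewrite sumC (exchange_big_dep predT) //= sumC (exchange_big_dep predT) //=.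
by ring.
Qed.

End GreenFunction.

Section Network.
Variables (R : realFieldType) (G : sgraph) (E : finType) (hd tl : E -> G).
Hypothesis adjE : forall x y,
  adj x y = [exists e, ((hd e == x) && (tl e == y)) || ((tl e == x) && (hd e == y))].
Hypothesis edge_inj : forall e f,
  (hd e == hd f) && (tl e == tl f) || (tl e == hd f) && (hd e == tl f) -> e = f.

Lemma sum_adj (x : G) (h : G -> R) :
  \sum_(y | adj x y) h y =
  \sum_e ((hd e == x)%:R * h (tl e) + (tl e == x)%:R * h (hd e)).
Proof.
pose inc e x y := (hd e == x) && (tl e == y) || (tl e == x) && (hd e == y).
have loopF e : hd e != tl e.
  apply/eqP => he; suff : adj (hd e) (hd e) by rewrite adj_irrefl.
  by rewrite adjE; apply/existsP; exists e; rewrite -he eqxx.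
have incE e y : (inc e x y)%:R =
    (hd e == x)%:R * (tl e == y)%:R + (tl e == x)%:R * (hd e == y)%:R :> R.
  have : ~~ ((hd e == x) && (tl e == x)).
    by apply: contra (loopF e) => /andP[/eqP-> /eqP->].
  rewrite /inc; move: (hd e == x) (tl e == x) (hd e == y) (tl e == y).
  by do 4!case; rewrite ?(mul1r, mul0r, addr0, add0r).
transitivity (\sum_y \sum_e (inc e x y)%:R * h y).
  rewrite big_mkcond; apply: eq_bigr => y _; rewrite -mulr_suml.
  case: ifP; rewrite adjE.
    case/existsP=> e0 ie0; rewrite (bigD1 e0) //= [in inc _ _ _]/inc ie0.
    rewrite big1 ?addr0 ?mul1r // => e ne; case ie: (inc e x y) => //.
    case/eqP: ne; apply: edge_inj; move: ie ie0; rewrite /inc.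
    by do 2!(case/orP; case/andP=> /eqP<- /eqP<-) => //; rewrite ?eqxx ?orbT.
  move/negbT/existsPn => ne; rewrite big1 ?mul0r // => e _.
  by rewrite /inc (negPf (ne e)).
rewrite exchange_big; apply: eq_bigr => e _ /=.
under eq_bigr => y _ do rewrite incE mulrDl -!mulrA.
by rewrite big_split /= -!mulr_sumr !sum_indicator.
Qed.

Lemma laplacian_edges (x : G) (phi : G -> R) :
  \sum_(y | adj x y) (phi x - phi y) =
  \sum_e ((tl e == x)%:R - (hd e == x)%:R) * (phi (tl e) - phi (hd e)).
Proof.
rewrite sum_adj; apply: eq_bigr => e _ /=.
by case: eqP => [<-|_]; case: eqP => [<-|_] /=; ring.
Qed.

Variables (n : nat) (f : G -> E -> R) (C : 'I_n -> E -> R) (kappa : E -> 'I_n -> R).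
Variables (gamma : 'I_n -> 'I_n -> R) (p : {ffun G -> R}).

Let dot (g h : E -> R) := \sum_e g e * h e.

(* A positive current on [e] goes from [tl e] to [hd e]. The flow [f u] sends a
   unit current from [u] to the distribution [p], the [C j] are circulations
   with Gram matrix inverse to [gamma], and they span the cycle space in the
   sense that [f (tl e) - f (hd e)] is the edge [e] up to the [C j]. *)
Hypothesis f_div : forall u (phi : G -> R),
  \sum_e f u e * (phi (tl e) - phi (hd e)) = phi u - \sum_x p x * phi x.
Hypothesis C_div : forall j (phi : G -> R),
  \sum_e C j e * (phi (tl e) - phi (hd e)) = 0.
Hypothesis f_diff : forall e e',
  f (tl e) e' - f (hd e) e' = (e == e')%:R + \sum_j kappa e j * C j e'.
Hypothesis gam_inv : forall m j, \sum_l gamma m l * dot (C l) (C j) = (m == j)%:R.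

(** As [gamma] inverts the Gram matrix, [Phi u v] is the inner product of the components of [f u]
    and [f v] orthogonal to the cycle space. *)
Let b u l := dot (f u) (C l).
Let Phi u v := dot (f u) (f v) - \sum_m \sum_l b u m * gamma m l * b v l.

(** The component of [f u] orthogonal to the cycles ignores the [C j], so pairing it with
    [f (tl e) - f (hd e)] reads off its value on [e]. Hence the gradient of [Phi u] is [f u] minus a
    circulation and has the divergence of [f u]. *)
Lemma flow_green u x :
  \sum_(y | adj x y) (Phi u x - Phi u y) = (x == u)%:R - p x.
Proof.
have dotD (g h k : E -> R) (c : 'I_n -> R) e :
  (forall e', h e' - k e' = (e == e')%:R + \sum_j c j * C j e') ->
  dot g h - dot g k = g e + \sum_j c j * dot g (C j).
  move=> hk; rewrite /dot -sumrB.
  under eq_bigr => e' _ do rewrite -mulrBr hk mulrDr [g e' * (_ == _)%:R]mulrC.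
  rewrite big_split /= sum_indicator; congr (_ + _).
  under eq_bigr => e' _ do rewrite mulr_sumr.
  rewrite exchange_big; apply: eq_bigr => j _; rewrite mulr_sumr.
  by apply: eq_bigr => e' _; rewrite mulrCA.
have dotC g h : dot g h = dot h g by apply: eq_bigr => e _; rewrite mulrC.
pose y l := \sum_m b u m * gamma m l.
have PhiE v : Phi u v = dot (f u) (f v) - \sum_l y l * b v l.
  rewrite /Phi exchange_big; congr (_ - _); apply: eq_bigr => l _.
  by rewrite mulr_suml.
have dPhi e : Phi u (tl e) - Phi u (hd e) = f u e - \sum_l y l * C l e.
  transitivity ((dot (f u) (f (tl e)) - dot (f u) (f (hd e)))
    - \sum_l y l * (b (tl e) l - b (hd e) l)).
    rewrite !PhiE; under [in RHS]eq_bigr => l _ do rewrite mulrBr.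
    by rewrite sumrB; ring.
  rewrite (dotD _ _ _ _ _ (f_diff e)) -addrA; congr (_ + _).
  under [X in _ - X]eq_bigr => l _ do
    rewrite /b ![dot (f _) (C l)]dotC (dotD _ _ _ _ _ (f_diff e)) mulrDr.
  rewrite big_split opprD addrCA /= -[RHS]addr0; congr (_ + _).
  under [X in _ - X]eq_bigr => l _ do rewrite mulr_sumr.
  rewrite exchange_big -sumrB big1 // => j _ /=.
  under eq_bigr => l _ do rewrite mulrCA dotC.
  rewrite -mulr_sumr; under eq_bigr => l _ do rewrite mulr_suml.
  rewrite exchange_big /= (_ : dot (f u) (C j) = \sum_m (j == m)%:R * b u m).
    rewrite -mulrBr -sumrB big1 ?mulr0 // => m _.
    under eq_bigr => l _ do rewrite -mulrA dotC.
    by rewrite -mulr_sumr gam_inv eq_sym mulrC subrr.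
  by rewrite sum_indicator.
rewrite laplacian_edges; under eq_bigr => e _ do rewrite dPhi mulrBr mulrC.
rewrite sumrB (f_div u (fun z => (z == x)%:R)).
rewrite [X in _ - X = _](_ : _ = 0) ?subr0.
  congr (_ - _); first by rewrite eq_sym.
  by rewrite -[RHS](sum_indicator x p); apply: eq_bigr => z _; rewrite mulrC eq_sym.
under eq_bigr => e _ do rewrite mulr_sumr.
rewrite exchange_big big1 //= => l _.
under eq_bigr => e _ do rewrite mulrCA [_ * C l e]mulrC.
by rewrite -mulr_sumr (C_div l (fun z => (z == x)%:R)) mulr0.
Qed.

Lemma Kirchhoff_index_flow :
  sg_connected G ->
  Kirchhoff_index R G =
    #|G|%:R * (\sum_u dot (f u) (f u)) - \sum_e (\sum_u f u e) ^+ 2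
  - \sum_m \sum_l gamma m l *
      (#|G|%:R * (\sum_u b u m * b u l) - (\sum_u b u m) * (\sum_u b u l)).
Proof.
move=> Gconn; rewrite (Kirchhoff_index_green Gconn flow_green) /Phi.
have -> : \sum_u \sum_v (dot (f u) (f v) - \sum_m \sum_l b u m * gamma m l * b v l)
    = \sum_e (\sum_u f u e) ^+ 2
      - \sum_m \sum_l gamma m l * ((\sum_u b u m) * (\sum_u b u l)).
  under eq_bigr => u _ do rewrite sumrB.
  rewrite sumrB; congr (_ - _).
    under [RHS]eq_bigr => e _ do rewrite expr2 mulr_suml.
    rewrite [RHS]exchange_big; apply: eq_bigr => u _.
    under [RHS]eq_bigr => e _ do rewrite mulr_sumr.
    by rewrite [RHS]exchange_big.
  under eq_bigr => u _ do rewrite exchange_big.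
  rewrite exchange_big; apply: eq_bigr => m _.
  under eq_bigr => u _ do rewrite exchange_big.
  rewrite exchange_big; apply: eq_bigr => l _.
  rewrite mulr_suml mulr_sumr; apply: eq_bigr => u _.
  rewrite !mulr_sumr; apply: eq_bigr => v _; ring.
rewrite sumrB.
have -> : \sum_u \sum_m \sum_l b u m * gamma m l * b u l =
    \sum_m \sum_l gamma m l * \sum_u b u m * b u l.
  rewrite exchange_big; apply: eq_bigr => m _.
  rewrite exchange_big; apply: eq_bigr => l _.
  by rewrite mulr_sumr; apply: eq_bigr => u _; ring.
have -> : \sum_m \sum_l gamma m l * (#|G|%:R * (\sum_u b u m * b u l)
      - (\sum_u b u m) * \sum_u b u l) =
    #|G|%:R * (\sum_m \sum_l gamma m l * \sum_u b u m * b u l)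
    - \sum_m \sum_l gamma m l * ((\sum_u b u m) * \sum_u b u l).
  rewrite mulr_sumr -sumrB; apply: eq_bigr => m _.
  by rewrite mulr_sumr -sumrB; apply: eq_bigr => l _; ring.
ring.
Qed.

End Network.

(** * Octagons as 8-cycles *)

Section Octagons.
Local Open Scope nat_scope.

Lemma infix2_map_iota (T : eqType) (g : nat -> T) (x y : T) (a m : nat) :
  infix [:: x; y] [seq g i | i <- iota a m.+1] ->
  exists2 i, a <= i < a + m & x = g i /\ y = g i.+1.
Proof.
elim: m a => [|m IH] a; first by rewrite /= !andbF.
rewrite [iota _ _]/= map_cons infix_consl => /orP[/=|].
  by rewrite prefix0s andbT => /andP[/eqP-> /eqP->]; exists a => //; lia.
by case/IH=> i hi xy; exists i => //; lia.
Qed.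

Lemma map_iota_infix2 (T : eqType) (g : nat -> T) (a m i : nat) :
  a <= i < a + m -> infix [:: g i; g i.+1] [seq g k | k <- iota a m.+1].
Proof.
move=> hi; have -> : m.+1 = (i - a) + (2 + (a + m - i.+1)) by lia.
rewrite iotaD map_cat iotaD map_cat /= (_ : a + (i - a) = i); last lia.
by apply: (infix_infix _ [:: g i; g i.+1]).
Qed.

Section Octagon.
Variables (n : nat) (t : 'I_n -> 'I_5).
Local Notation V := (chain_vertex n).

(* The cycle of octagon [j], from its top left corner through the top side and
   back through the bottom side: positions 0 and 8 are the top left corner,
   7 is the bottom left one, and the right rung joins [t j + 1] to [t j + 2]. *)
Definition oct (j : 'I_n) (s : nat) : V :=
  if (s == 0) || (s == 8) then inl (widen_ord (leqnSn n) j, true)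
  else if s == 7 then inl (widen_ord (leqnSn n) j, false)
  else if s == (t j).+1 then inl (lift ord0 j, true)
  else if s == (t j).+2 then inl (lift ord0 j, false)
  else inr (j, inord (if s <= t j then s.-1 else 6 + t j - s)).

Let enum4 : enum 'I_4 = [:: inord 0; inord 1; inord 2; inord 3].
Proof. by apply: (inj_map val_inj); rewrite val_enum_ord /= !inordK. Qed.

Lemma side_path_top (j : 'I_n) :
  side_path t j true = [seq oct j s | s <- iota 0 (t j).+2].
Proof.
rewrite /side_path enum4 /= !inordK // /oct.
by case: (t j) => -[|[|[|[|[|//]]]]] /=.
Qed.

Lemma side_path_bottom (j : 'I_n) :
  side_path t j false = rev [seq oct j s | s <- iota (t j).+2 (6 - t j)].
Proof.
rewrite /side_path enum4 /= !inordK // /oct.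
by case: (t j) => -[|[|[|[|[|//]]]]] /=.
Qed.

Lemma oct_top j : oct j (t j).+1 = inl (lift ord0 j, true).
Proof. by rewrite /oct eqxx; case: (t j) => -[|[|[|[|[|//]]]]]. Qed.

Lemma oct_bottom j : oct j (t j).+2 = inl (lift ord0 j, false).
Proof. by rewrite /oct eqxx; case: (t j) => -[|[|[|[|[|//]]]]]. Qed.

(** Rung [i + 1] is the right rung of octagon [i], and rung 0 is the left rung of octagon 0, which
    exists as [0 < n]. Every other edge lies on the top or bottom side of an octagon. *)
Lemma chain_adj_octP x y : 0 < n ->
  reflect (exists j s, s < 8 /\
     ((x, y) = (oct j s, oct j s.+1) \/ (y, x) = (oct j s, oct j s.+1)))
    (chain_adj t x y).
Proof.
move=> n0; apply: (iffP idP) => [|[j [s [s8 xy]]]].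
  have tj5 j := ltn_ord (t j).
  suff step u v : chain_step t u v -> exists j s, s < 8 /\
     ((u, v) = (oct j s, oct j s.+1) \/ (v, u) = (oct j s, oct j s.+1)).
    case/orP=> /step[j [s [s8 [] E]]]; exists j, s; split => //; tauto.
  case/orP=> [/existsP[i /andP[/eqP-> /eqP->]]|].
    case: (unliftP ord0 i) => [j|] ->.
      exists j, (t j).+1; split; first by have := tj5 j; lia.
      by left; rewrite oct_top oct_bottom.
    exists (Ordinal n0), 7; split => //; right.
    by congr (inl (_, _), inl (_, _)); apply: val_inj.
  case/existsP=> j /existsP[[]].
    rewrite side_path_top => /infix2_map_iota[s hs [-> ->]].
    exists j, s; split; [have := tj5 j; lia | by left].
  rewrite side_path_bottom -[_ :: _]/(rev [:: v; u]) infix_rev.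
  rewrite -[6 - t j]prednK; last by have := tj5 j; lia.
  case/infix2_map_iota=> s hs [-> ->].
  exists j, s; split; [have := tj5 j; lia | by right].
suff : chain_adj t (oct j s) (oct j s.+1).
  by case: xy => -[-> ->] //; rewrite /chain_adj orbC.
have tj := ltn_ord (t j).
have [lt|] := leqP s (t j).
  apply/orP; left; apply/orP; right; apply/existsP; exists j.
  apply/existsP; exists true; rewrite side_path_top.
  by apply: map_iota_infix2; lia.
rewrite leq_eqVlt => /orP[/eqP<-|lt].
  apply/orP; left; apply/orP; left; apply/existsP; exists (lift ord0 j).
  by rewrite oct_top oct_bottom !eqxx.
move: s8; rewrite ltnS leq_eqVlt => /orP[/eqP->|s7].
  apply/orP; right; apply/orP; left; apply/existsP.
  by exists (widen_ord (leqnSn n) j); rewrite /oct /= !eqxx.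
apply/orP; right; apply/orP; right; apply/existsP; exists j.
apply/existsP; exists false; rewrite side_path_bottom.
rewrite -[_ :: _]/(rev [:: oct j s; oct j s.+1]) infix_rev.
rewrite -[6 - t j]prednK; last lia.
by apply: map_iota_infix2; lia.
Qed.

(* Every vertex outside the first rung has a unique position [s + 1], [s < 6],
   in a unique octagon. *)
Definition coord (x : V) : bool + 'I_n * 'I_6 :=
  match x with
  | inl (i, b) => if unlift ord0 i is Some j then inr (j, inord (t j + ~~ b))
                  else inl b
  | inr (j, k) => inr (j, inord (if k < t j then val k else 5 + t j - k))
  end.

Definition of_coord (c : bool + 'I_n * 'I_6) : V :=
  match c with inl b => inl (ord0, b) | inr (j, s) => oct j s.+1 end.

Lemma coordK : cancel coord of_coord.
Proof.
case=> [[i b]|[j k]] /=.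
  case: unliftP => [j|] -> //=; have tj := ltn_ord (t j).
  rewrite inordK; last by case: b; lia.
  by case: b; rewrite ?addn0 ?addn1 ?oct_top ?oct_bottom.
have k4 := ltn_ord k; have tj := ltn_ord (t j).
rewrite inordK; last by case: ifP; lia.
rewrite /oct; case: (ltnP k (t j)) => kt; do 4!(rewrite ifF; last lia).
  by rewrite kt inord_val.
rewrite ifF; last lia; congr (inr (_, _)); apply: val_inj.
by rewrite /= inordK; lia.
Qed.

(** Both types have [6n + 2] elements, so the injection [coord] is bijective. *)
Lemma of_coordK : cancel of_coord coord.
Proof.
have card_eq : #|{: bool + 'I_n * 'I_6}| <= #|V|.
  by rewrite !card_sum !card_prod !card_ord card_bool; lia.
by have [g gK gK'] := inj_card_bij (can_inj coordK) card_eq; move=> c; rewrite -[c]gK' coordK.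
Qed.

Lemma coord_oct j (s : 'I_6) : coord (oct j s.+1) = inr (j, s).
Proof. exact: (of_coordK (inr (j, s))). Qed.

(* [Some (j, s)] joins the positions [s] and [s + 1] of octagon [j], so that the
   left rungs are counted in the previous octagon; [None] is the first rung. *)
Definition chain_edge := option ('I_n * 'I_7).
Definition edge_hd (e : chain_edge) : V :=
  if e is Some (j, s) then oct j s else inl (ord0, true).
Definition edge_tl (e : chain_edge) : V :=
  if e is Some (j, s) then oct j s.+1 else inl (ord0, false).

Definition left_rung (j : 'I_n) : chain_edge :=
  if unlift ord0 (widen_ord (leqnSn n) j) is Some i
  then Some (i, inord (t i).+1) else None.

Variant left_rung_spec (j : 'I_n) : chain_edge -> Type :=
  | LeftRung0 of j = 0 :> nat : left_rung_spec j None
  | LeftRungS (i : 'I_n) of j = i.+1 :> nat & oct j 0 = oct i (t i).+1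
      & oct j 7 = oct i (t i).+2 : left_rung_spec j (Some (i, inord (t i).+1)).

Lemma left_rungP j : left_rung_spec j (left_rung j).
Proof.
rewrite /left_rung; case: unliftP => [i|] E.
  constructor; first by have /(congr1 val) := E.
    by rewrite oct_top /oct -E.
  by rewrite oct_bottom /oct -E.
by constructor; have /(congr1 val) := E.
Qed.

Lemma oct_start (j : 'I_n) : j = 0 :> nat ->
  (oct j 0 = inl (ord0, true)) * (oct j 7 = inl (ord0, false)).
Proof. by move=> j0; split; congr (inl (_, _)); apply: val_inj. Qed.

Lemma left_rung_hd j : edge_hd (left_rung j) = oct j 0.
Proof.
case: left_rungP => [/oct_start-> //|i _ -> _] /=.
by rewrite inordK; last by have := ltn_ord (t i); lia.
Qed.

Lemma left_rung_tl j : edge_tl (left_rung j) = oct j 7.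
Proof.
case: left_rungP => [/oct_start-> //|i _ _ ->] /=.
by rewrite inordK; last by have := ltn_ord (t i); lia.
Qed.

Lemma left_rung_inj : injective left_rung.
Proof.
move=> i j; case: left_rungP => [i0|i' i1 _ _]; case: left_rungP => [j0|j' j1 _ _] //.
  by move=> _; apply: val_inj; rewrite /= i0 j0.
by case=> ij _; apply: val_inj; rewrite /= i1 j1 ij.
Qed.

Lemma chain_adjE x y : 0 < n ->
  chain_adj t x y = [exists e, ((edge_hd e == x) && (edge_tl e == y))
                            || ((edge_tl e == x) && (edge_hd e == y))].
Proof.
move=> n0; apply/(chain_adj_octP x y n0)/existsP => [[j [s [s8 xy]]]|].
  have [e] : exists e, (edge_hd e, edge_tl e) = (oct j s, oct j s.+1)
                    \/ (edge_tl e, edge_hd e) = (oct j s, oct j s.+1).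
    move: s8; rewrite ltnS leq_eqVlt => /orP[/eqP->|s7]; last first.
      by exists (Some (j, Ordinal s7)); left.
    by exists (left_rung j); right; rewrite left_rung_hd left_rung_tl.
  move=> E; exists e; case: E xy => -[-> ->] [] [-> ->]; rewrite !eqxx ?orbT //.
case=> e exy; suff [j [s [s8 E]]] : exists j s, s < 8 /\
     ((edge_hd e, edge_tl e) = (oct j s, oct j s.+1) \/
      (edge_tl e, edge_hd e) = (oct j s, oct j s.+1)).
  by exists j, s; split => //; case/orP: exy => /andP[/eqP<- /eqP<-]; tauto.
case: e {exy} => [[j s]|] /=.
  by exists j, s; split; [have := ltn_ord s; lia|left].
by exists (Ordinal n0), 7; split => //; right; rewrite -[oct _ 8]/(oct (Ordinal n0) 0) !oct_start.
Qed.

(* Numbering the vertices along the chain, octagon j holds the labels 6j + 2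
   to 6j + 7, and the labels of its left rung are smaller. *)
Let label (x : V) : nat :=
  match coord x with inl b => ~~ b | inr (j, s) => 6 * j + s + 2 end.

Let label_oct j s : 0 < s < 7 -> label (oct j s) = 6 * j + s + 1.
Proof.
move=> hs; have s6 : s.-1 < 6 by lia.
rewrite -[s]prednK; last lia.
by rewrite /label (coord_oct j (Ordinal s6)) /=; lia.
Qed.

Let label_rung j : (label (oct j 0) <= 6 * j + 1) * (label (oct j 7) <= 6 * j + 1).
Proof.
rewrite -left_rung_hd -left_rung_tl; case: left_rungP => [j0|i ij _ _].
  by rewrite /label /= unlift_none /=; split; lia.
have ti := ltn_ord (t i); rewrite /= inordK; last lia.
by split; rewrite label_oct; lia.
Qed.

Lemma edge_ends_inj e f :
  (edge_hd e == edge_hd f) && (edge_tl e == edge_tl f)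
  || (edge_tl e == edge_hd f) && (edge_hd e == edge_tl f) -> e = f.
Proof.
pose a (g : chain_edge) := label (edge_hd g); pose b (g : chain_edge) := label (edge_tl g).
(* The larger label determines [j]. It also gives [s], except that [6j + 7] occurs for both [s = 5]
   and [s = 6], which the smaller label tells apart. *)
have ab g : match g with
    | None => (a g = 0) /\ (b g = 1)
    | Some (j, s) => (a g <= 6 * j + 1 /\ s = 0 :> nat \/ 0 < s /\ a g = 6 * j + s + 1) /\
                     (b g <= 6 * j + 1 /\ s = 6 :> nat \/ s < 6 /\ b g = 6 * j + s + 2)
    end.
  rewrite /a /b; case: g => [[j s]|] /=; last by rewrite /label /= unlift_none.
  have s7 := ltn_ord s; have [l0 l7] := label_rung j; split.
    by case: (posnP s) => [->|s0]; [left|right; rewrite label_oct; lia].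
  case: (ltnP s 6) => s6; first by right; rewrite label_oct; lia.
  by left; rewrite (_ : nat_of_ord s = 6); lia.
move=> ef; have {ef} : a e = a f /\ b e = b f \/ b e = a f /\ a e = b f.
  by rewrite /a /b; case/orP: ef => /andP[/eqP-> /eqP->]; tauto.
move: (ab e) (ab f); case: e f => [[j s]|] [[i r]|] //.
- move=> he hf h; have [ji sr] : j = i :> nat /\ s = r :> nat.
    by have := ltn_ord s; have := ltn_ord r; lia.
  by congr (Some (_, _)); apply: val_inj.
- by have := ltn_ord s; lia.
- by have := ltn_ord r; lia.
Qed.

Lemma sum_of_coord (R : nmodType) (h : V -> R) :
  (\sum_v h v = \sum_c h (of_coord c))%R.
Proof.
by rewrite (reindex of_coord) //=; exists coord => c _;
  [exact: of_coordK|exact: coordK].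
Qed.

Lemma card_chain : #|chain t| = 6 * n + 2.
Proof. by rewrite card_sum !card_prod !card_ord card_bool; lia. Qed.

End Octagon.

End Octagons.

(** * Flows in a chain *)

Section SquareFlows.
Variable R : realFieldType.

(* Leftward flows in one octagon, on the edge between positions [k] and [k + 1]:
   [thru v] enters by halves at the ends [v + 1], [v + 2] of the right rung,
   [exit_flow s] enters at position [s + 1]; both leave by halves at 0 and 7. *)
Definition thru (v k : nat) : R :=
  if (k <= v)%N then 2^-1 else if k == v.+1 then 0 else - 2^-1.
Definition exit_flow (s k : nat) : R := if (k <= s)%N then 2^-1 else - 2^-1.

Lemma thru_potential (v : nat) (g : nat -> R) : (v < 5)%N ->
  \sum_(k < 7) thru v k * (g k.+1 - g k) =
    2^-1 * (g v.+1 + g v.+2) - 2^-1 * (g 0%N + g 7%N).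
Proof.
by move: v => [|[|[|[|[|//]]]]] _; rewrite !big_ord_recl big_ord0 /thru /= ?/bump /=; field.
Qed.

Lemma exit_potential (s : nat) (g : nat -> R) : (s < 6)%N ->
  \sum_(k < 7) exit_flow s k * (g k.+1 - g k) = g s.+1 - 2^-1 * (g 0%N + g 7%N).
Proof.
by move: s => [|[|[|[|[|[|//]]]]]] _; rewrite !big_ord_recl big_ord0 /exit_flow /= ?/bump /=; field.
Qed.

(** The [v + 1] top edges count [1/2] and the [5 - v] bottom edges [-1/2]: this is how the offsets
    enter the circulations. *)
Lemma sum_thru v : (v < 5)%N -> \sum_(k < 7) thru v k = v%:R - 2.
Proof.
by move: v => [|[|[|[|[|//]]]]] _; rewrite !big_ord_recl big_ord0 /thru /= ?/bump /=; field.
Qed.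

Lemma sum_thru_sqr v : (v < 5)%N -> \sum_(k < 7) thru v k ^+ 2 = 3 / 2.
Proof.
by move: v => [|[|[|[|[|//]]]]] _; rewrite !big_ord_recl big_ord0 /thru /= ?/bump /=; field.
Qed.

Lemma sum_thru_exit v : (v < 5)%N ->
  \sum_(k < 7) thru v k * (3 - k%:R) = (12 - (v%:R - 2) ^+ 2) / 2.
Proof.
by move: v => [|[|[|[|[|//]]]]] _; rewrite !big_ord_recl big_ord0 /thru /= ?/bump /=; field.
Qed.

Lemma sum_exit s : (s < 6)%N -> \sum_(k < 7) exit_flow s k = s%:R - 5 / 2.
Proof.
by move: s => [|[|[|[|[|[|//]]]]]] _; rewrite !big_ord_recl big_ord0 /exit_flow /= ?/bump /=; field.
Qed.

Lemma sum_exit_sqr s : (s < 6)%N -> \sum_(k < 7) exit_flow s k ^+ 2 = 7 / 4.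
Proof.
by move: s => [|[|[|[|[|[|//]]]]]] _; rewrite !big_ord_recl big_ord0 /exit_flow /= ?/bump /=; field.
Qed.

Lemma sum_exits k : (k < 7)%N -> \sum_(s < 6) exit_flow s k = 3 - k%:R.
Proof.
by move: k => [|[|[|[|[|[|[|//]]]]]]] _; rewrite !big_ord_recl big_ord0 /exit_flow /= ?/bump /=; field.
Qed.

Lemma sum_exit_rung v : (v < 5)%N ->
  \sum_(s < 6) - exit_flow s v.+1 = v%:R - 2.
Proof.
by move: v => [|[|[|[|[|//]]]]] _; rewrite !big_ord_recl big_ord0 /exit_flow /= ?/bump /=; field.
Qed.

Lemma sum_exit_rung_pos v : (v < 5)%N ->
  \sum_(s < 6) (s%:R - 5 / 2) * - exit_flow s v.+1 = ((v%:R - 2) ^+ 2 - 9) / 2.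
Proof.
by move: v => [|[|[|[|[|//]]]]] _; rewrite !big_ord_recl big_ord0 /exit_flow /= ?/bump /=; field.
Qed.

(** Entering at one end of the right rung, instead of by halves at both, sends half a unit along the
    rung. *)
Lemma exit_thru v k : exit_flow v k = thru v k - 2^-1 * (k == v.+1)%:R.
Proof.
rewrite /thru /exit_flow; case: leqP => [kv|vk]; last case: eqP => _ /=; try ring.
by rewrite ltn_eqF ?ltnS //=; ring.
Qed.

Lemma exit_thruS v k : exit_flow v.+1 k = thru v k + 2^-1 * (k == v.+1)%:R.
Proof.
rewrite /thru /exit_flow (leq_eqVlt k v.+1) ltnS.
case: eqP => [->|_] /=; first by rewrite ltnn; ring.
by case: (k <= v)%N; ring.
Qed.

End SquareFlows.

Section ChainFlow.
Variables (R : realFieldType) (n : nat) (t : 'I_n -> 'I_5).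
Local Notation E := (chain_edge n).

Lemma sum_edge (g : E -> R) :
  \sum_e g e = g None + \sum_j \sum_k g (Some (j, k)).
Proof.
rewrite (bigD1 None) //= pair_big /=; congr (_ + _).
rewrite (reindex_omap (Some) id) /=; last by case.
by apply: eq_big => [e|[j k] _] //=; rewrite eqxx.
Qed.

Lemma some_edge_eqE (i l : 'I_n) (k k' : 'I_7) :
  (Some (i, k) == Some (l, k') :> E) = (i == l) && (k == k').
Proof. by rewrite (inj_eq (@Some_inj _)) xpair_eqE. Qed.

(** A start uses [exit_flow] in its own octagon and [thru] in all earlier ones: what leaves an
    octagon by halves at its left rung enters the previous one in the same way. *)
Definition flow (c : bool + 'I_n * 'I_6) (e : E) : R :=
  match c, e with
  | inl b, None => if b then - 2^-1 else 2^-1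
  | inr (j, s), Some (l, k) =>
      if (l < j)%N then thru R (t l) k
      else if l == j then exit_flow R s k else 0
  | _, _ => 0
  end.

(** [omap fst] picks the seven edges listed under octagon [j]. The left rung, listed elsewhere,
    counts negatively because its head is at position 0 and its tail at position 7. *)
Definition loop (j : 'I_n) (e : E) : R :=
  (omap fst e == Some j)%:R - (left_rung t j == e)%:R.

Definition dot (g h : E -> R) : R := \sum_e g e * h e.

Lemma dot_loop g j : dot g (loop j) = \sum_k g (Some (j, k)) - g (left_rung t j).
Proof.
rewrite /dot; under eq_bigr => e _ do rewrite /loop mulrBr [X in _ - X]mulrC.
rewrite sumrB sum_indicator sum_edge mulr0 add0r; congr (_ - _).
rewrite (bigD1 j) //= [X in _ + X]big1 ?addr0.
  by apply: eq_bigr => k _; rewrite eqxx mulr1.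
by move=> i ij; rewrite big1 // => k _; rewrite /eq_op /= (negPf ij) mulr0.
Qed.

Lemma loop_div j (phi : chain_vertex n -> R) :
  \sum_e loop j e * (phi (edge_tl t e) - phi (edge_hd t e)) = 0.
Proof.
under eq_bigr => e _ do rewrite mulrC.
rewrite [LHS](dot_loop (fun e => phi (edge_tl t e) - phi (edge_hd t e)) j).
rewrite left_rung_hd left_rung_tl !big_ord_recl big_ord0 /=; ring.
Qed.

Lemma loop_gram (l j : 'I_n) : dot (loop l) (loop j) =
  8 * (l == j)%:R - (l == j.+1 :> nat)%:R - (j == l.+1 :> nat)%:R.
Proof.
rewrite dot_loop.
have -> : \sum_k loop l (Some (j, k)) = 7 * (l == j)%:R - (l == j.+1 :> nat)%:R.
  rewrite sumrB sumr_const card_ord eq_sym mulr_natl; congr (_ - _).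
  case: (left_rungP t l) => [l0|i li _ _].
    by rewrite l0 big1.
  have ti := ltn_ord (t i).
  rewrite (bigD1 (inord (t i).+1)) //= big1 ?addr0; last first.
    by move=> k /negPf nk; rewrite /eq_op /= /eq_op /= [_ == k]eq_sym nk andbF.
  by rewrite /eq_op /= /eq_op /= eqxx andbT li.
have -> : loop l (left_rung t j) = (j == l.+1 :> nat)%:R - (l == j)%:R.
  rewrite /loop (inj_eq (@left_rung_inj n t)); congr (_%:R - _).
  by case: (left_rungP t j) => [->|i ji _ _] //; rewrite ji eqSS.
ring.
Qed.

Definition base (j : 'I_n) (e : E) : R :=
  if e is Some (l, k) then if (l < j)%N then thru R (t l) k else 0 else 0.

(** [base j] enters by halves at both ends of the left rung of [j]. Except for [j = 0], these ends
    have their coordinates in the previous octagon, where [exit_thru] and [exit_thruS] apply. *)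
Lemma flow_rung (j : 'I_n) e :
  (flow (coord t (oct t j 0)) e = base j e - 2^-1 * (left_rung t j == e)%:R) *
  (flow (coord t (oct t j 7)) e = base j e + 2^-1 * (left_rung t j == e)%:R).
Proof.
case: (left_rungP t j) => [j0|i ji -> ->].
  rewrite !(oct_start t j0) /= unlift_none.
  case: e => [[l k]|] /=; last by rewrite mulr1 sub0r add0r.
  by rewrite j0 /= mulr0 subr0 addr0.
have ti := ltn_ord (t i).
have i0 : ((t i) < 6)%N by lia.
have i1 : ((t i).+1 < 6)%N by lia.
rewrite (coord_oct t i (Ordinal i0)) (coord_oct t i (Ordinal i1)).
case: e => [[l k]|] /=; last by rewrite mulr0 subr0 addr0.
have -> : (Some (i, inord (t i).+1) == Some (l, k) :> chain_edge n) =
    (l == i :> nat) && (k == (t i).+1 :> nat).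
  rewrite some_edge_eqE eq_sym -val_eqE /= [inord _ == k]eq_sym -(val_eqE k) /=.
  by rewrite inordK //; lia.
rewrite ji ltnS -(val_eqE l i) /=; case: (ltngtP l i) => li /=;
  [by rewrite mulr0 subr0 addr0..|].
have -> : l = i by apply: val_inj.
by rewrite -exit_thru -exit_thruS.
Qed.

(** Moving the start of a flow along an edge changes the flow by that edge alone, except at
    positions 0 and 6, next to the left rung, where half the cycle is subtracted as well. *)
Definition loop_coef (e : E) (j : 'I_n) : R :=
  if e is Some (l, k) then
    (l == j)%:R * (if (k == 0%N :> nat) || (k == 6%N :> nat) then - 2^-1 else 0)
  else 0.

Lemma flow_inr (j : 'I_n) (s : 'I_6) (e : E) :
  flow (inr (j, s)) e =
    base j e + if e is Some (l, k) then if l == j then exit_flow R s k else 0 else 0.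
Proof.
case: e => [[l k]|] /=; last by rewrite addr0.
by case: (eqVneq l j) => [->|_]; [rewrite ltnn add0r|case: ifP; rewrite addr0].
Qed.

Lemma flow_diff (e e' : E) :
  flow (coord t (edge_tl t e)) e' - flow (coord t (edge_hd t e)) e' =
    (e == e')%:R + \sum_j loop_coef e j * loop j e'.
Proof.
case: e => [[l k]|]; last first.
  rewrite /= big1 ?unlift_none; last by move=> j _; rewrite mul0r.
  by case: e' => [[i k']|] /=; [rewrite subrr addr0|field].
rewrite [X in _ = _ + X](_ : _ = (if (k == 0%N :> nat) || (k == 6%N :> nat)
    then - 2^-1 else 0) * loop l e'); last first.
  under eq_bigr => j _ do rewrite /= -mulrA.
  exact: (sum_indicator l (fun j => _ * loop j e')).
have -> : loop l e' = (if e' is Some (i, _) then (i == l)%:R else 0)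
                     - (left_rung t l == e')%:R.
  by case: e' => [[i k']|].
pose ex (f : E) s := if f is Some (i, k') then if i == l then exit_flow R s k' else 0 else 0.
have ex_in (s : nat) (s6 : (s < 6)%N) : flow (coord t (oct t l s.+1)) e' = base l e' + ex e' s.
  by rewrite (coord_oct t l (Ordinal s6)) flow_inr.
have exB f s : (s < 6)%N -> ex f s.+1 - ex f s = (f == (Some (l, inord s.+1) : E))%:R.
  rewrite /ex; case: f => [[i k']|] s6; last by rewrite subrr.
  rewrite some_edge_eqE -(val_eqE k') /= inordK //; case: eqP => _; last by rewrite subrr.
  by rewrite exit_thruS exit_thru /=; case: eqP => _ /=; field.
have ex0 f : ex f 0%N = (f == (Some (l, ord0) : E))%:R
    - 2^-1 * (if f is Some (i, _) then (i == l)%:R else 0).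
  rewrite /ex; case: f => [[i k']|]; last by rewrite mulr0 subr0.
  rewrite some_edge_eqE -(val_eqE k') /=; case: eqP => _ /=; last by ring.
  by rewrite /exit_flow leqn0; case: eqP => _ /=; field.
have ex6 f : ex f 5%N = 2^-1 * (if f is Some (i, _) then (i == l)%:R else 0)
    - (f == (Some (l, inord 6) : E))%:R.
  rewrite /ex; case: f => [[i k']|]; last by rewrite mulr0 subr0.
  rewrite some_edge_eqE -(val_eqE k') /= inordK //; case: eqP => _ /=; last by ring.
  rewrite /exit_flow; have := ltn_ord k'; rewrite ltnS leq_eqVlt ltnS.
  by case: eqP => [->|_] /=; [move=> _|move=> ->]; field.
have lin0 (a p x y : R) : a + (p - 2^-1 * x) - (a - 2^-1 * y) = p + - 2^-1 * (x - y).
  by ring.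
have lin6 (a p x y : R) : a + 2^-1 * y - (a + (2^-1 * x - p)) = p + - 2^-1 * (x - y).
  by ring.
have k7 := ltn_ord k; rewrite /= [Some (l, k) == e']eq_sym.
case: (posnP k) => [k0|k0].
  have -> : k = ord0 by apply: val_inj.
  rewrite /= (ex_in 0%N) // flow_rung ex0; exact: lin0.
have [k6|k6] : (k = 6%N :> nat) \/ (k < 6)%N by lia.
  have -> : k = inord 6 by apply: val_inj; rewrite /= inordK.
  rewrite inordK // /= flow_rung (ex_in 5%N) // ex6; exact: lin6.
have kE : nat_of_ord k = k.-1.+1 by rewrite prednK.
case: ifP => [h|_]; first lia.
rewrite mul0r addr0 kE !ex_in; try lia.
rewrite opprD addrACA subrr add0r exB; last lia.
by congr ((e' == Some (l, _))%:R); apply: val_inj; rewrite /= inordK -?kE.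
Qed.

(* The flows end by halves at the two ends of the first rung. *)
Lemma flow_div c (phi : chain_vertex n -> R) :
  \sum_e flow c e * (phi (edge_tl t e) - phi (edge_hd t e)) =
  phi (of_coord t c) - 2^-1 * (phi (inl (ord0, true)) + phi (inl (ord0, false))).
Proof.
rewrite sum_edge; case: c => [b|[j s]] /=.
  rewrite big1 => [|l _]; last by rewrite big1 // => k _; rewrite mul0r.
  by case: b; field.
rewrite mul0r add0r.
(* [mu i] is the mean of [phi] over rung [i]. Each crossed octagon contributes [mu l.+1 - mu l], and
   these telescope down to the first rung. *)
pose mu i := 2^-1 * (phi (inl (inord i, true)) + phi (inl (inord i, false))).
transitivity (\sum_(l < n) ((if (l < j)%N then mu l.+1 - mu l else 0) +
   (j == l)%:R * (phi (oct t l s.+1) - mu l))).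
  apply: eq_bigr => l _.
  have muE : mu l = 2^-1 * (phi (oct t l 0) + phi (oct t l 7)).
    have E0 : widen_ord (leqnSn n) l = inord l.
      by apply: val_inj; rewrite /= inordK // ltnS ltnW.
    by rewrite /mu /oct /= E0.
  have [-> ->] : (l == j) = (l == j :> nat) /\ (j == l) = (j == l :> nat) by [].
  case: (ltngtP l j) => lj.
  - rewrite mul0r addr0.
    rewrite (thru_potential (fun k => phi (oct t l k))) // oct_top oct_bottom muE.
    by congr (2^-1 * (phi (inl (_, _)) + phi (inl (_, _))) - _);
      apply: val_inj; rewrite /= inordK // ltnS.
  - rewrite mul0r addr0.
    by rewrite big1 // => k _; rewrite mul0r.
  have -> : l = j by apply: val_inj.
  rewrite add0r mul1r (exit_potential (fun k => phi (oct t j k))) //.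
  by rewrite -[in mu j](val_inj lj) muE (val_inj lj).
rewrite big_split /= (sum_indicator j (fun l => phi (oct t l s.+1) - mu l)).
rewrite -big_mkcond /= -(big_ord_widen n (fun l => mu l.+1 - mu l)); last exact: ltnW.
rewrite -(big_mkord xpredT (fun l => mu l.+1 - mu l)) (telescope_sumr mu (leq0n j)).
have -> : mu 0%N = 2^-1 * (phi (inl (ord0, true)) + phi (inl (ord0, false))).
  by rewrite /mu (_ : inord 0 = ord0 :> 'I_n.+1) //; apply: val_inj; rewrite /= inordK.
ring.
Qed.

Definition offset (i : nat) : R := if insub i is Some j then (t j)%:R - 2 else 0.

Lemma offsetE (j : 'I_n) : offset j = (t j)%:R - 2.
Proof. by rewrite /offset valK. Qed.

(** For a start in octagon [j], the left rung of [l] contributes only if [l = j + 1], since [thru]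
    vanishes on right rungs. *)
Lemma loop_flow c (l : 'I_n) : dot (flow c) (loop l) =
  match c with
  | inl b => (l == 0%N :> nat)%:R * (if b then 2^-1 else - 2^-1)
  | inr (j, s) => (l < j)%:R * offset l + (l == j)%:R * (s%:R - 5 / 2)
                + (l == j.+1 :> nat)%:R * - exit_flow R s (t j).+1
  end.
Proof.
rewrite dot_loop; case: c => [b|[j s]] /=.
  rewrite big1 // sub0r; case: (left_rungP t l) => [->|i -> _ _] /=.
    by rewrite mul1r; case: b; rewrite ?opprK.
  by rewrite mul0r oppr0.
have -> : \sum_(k < 7) (if (l < j)%N then thru R (t l) k
     else if l == j then exit_flow R s k else 0) =
   (l < j)%:R * offset l + (l == j)%:R * (s%:R - 5 / 2).
  rewrite offsetE; case: (ltngtP l j) => lj.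
  - by rewrite sum_thru // -val_eqE /= (ltn_eqF lj) mul1r mul0r addr0.
  - by rewrite -val_eqE /= (gtn_eqF lj) big1 // !mul0r addr0.
  have -> : l = j by apply: val_inj.
  by rewrite eqxx sum_exit // mul0r add0r mul1r.
congr (_ + _); case: (left_rungP t l) => [->|i -> _ _] /=.
  by rewrite mul0r oppr0.
rewrite eqSS.
have ti := ltn_ord (t i); rewrite inordK; last lia.
rewrite -[i == j]/(i == j :> nat); case: (ltngtP i j) => ij.
- by rewrite /thru ltnn eqxx mul0r oppr0.
- by rewrite mul0r oppr0.
by rewrite (val_inj ij) mul1r.
Qed.

(** Each crossed octagon contributes [3/2] and the octagon of the start [7/4], whatever [t] is, so
    the norms enter only the constant. *)
Lemma flow_norm c : dot (flow c) (flow c) =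
  if c is inr (j, _) then 3 / 2 * j%:R + 7 / 4 else 4^-1.
Proof.
rewrite /dot sum_edge; case: c => [b|[j s]] /=.
  rewrite big1 => [|l _]; last by rewrite big1 // => k _; rewrite mul0r.
  by case: b; field.
rewrite mul0r add0r.
transitivity (\sum_(l < n) ((if (l < j)%N then 3 / 2 else 0) + (j == l)%:R * (7 / 4)) : R).
  apply: eq_bigr => l _.
  have [-> ->] : (l == j) = (l == j :> nat) /\ (j == l) = (j == l :> nat) by [].
  case: (ltngtP l j) => lj.
  - by rewrite mul0r addr0 -(sum_thru_sqr R (ltn_ord (t l))).
  - by rewrite big1 => [|k _]; rewrite ?mul0r ?addr0.
  by rewrite mul1r add0r -(sum_exit_sqr R (ltn_ord s)).
rewrite big_split /= (sum_indicator j (fun=> 7 / 4)) -big_mkcond /=; congr (_ + _).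
rewrite -(big_ord_widen n (fun=> 3 / 2)); last exact: ltnW.
by rewrite sumr_const card_ord mulr_natr.
Qed.

End ChainFlow.

(** * Inverse of the Gram matrix and the quadratic form *)

Section LoopGreen.
Variable R : realFieldType.

(* The solution of the recurrence [8 c_(k+1) = c_k + c_(k+2)] attached to the
   tridiagonal matrix of [loop_gram]. *)
Fixpoint cheb_pair (k : nat) : R * R :=
  if k is k'.+1 then ((cheb_pair k').2, 8 * (cheb_pair k').2 - (cheb_pair k').1)
  else (0, 1).
Definition cheb k := (cheb_pair k).1.

Lemma chebSS k : cheb k.+2 = 8 * cheb k.+1 - cheb k. Proof. by []. Qed.

Lemma cheb_lt k : 0 <= cheb k < cheb k.+1.
Proof.
elim: k => [|k /andP[h0 h1]]; first by rewrite /cheb /= lexx ltr01.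
by rewrite chebSS; apply/andP; split; lra.
Qed.

Lemma cheb_gt0 k : 0 < cheb k.+1.
Proof. by have /andP[h0 h1] := cheb_lt k; lra. Qed.

(** The addition formula of the Chebyshev polynomials of the second kind at 4: [cheb k.+1] is
    [U_k(4)]. *)
Lemma chebD a b : cheb a.+2 * cheb b.+1 - cheb a.+1 * cheb b = cheb (a + b).+2.
Proof.
elim: a b => [|a IH] b; first by rewrite add0n !chebSS /cheb /=; ring.
by rewrite addSnnS -IH (chebSS a.+1) (chebSS b); ring.
Qed.

Lemma sum_ord_eq (n k : nat) (g : nat -> R) :
  \sum_(l < n) (l == k :> nat)%:R * g l = if (k < n)%N then g k else 0.
Proof.
case: ifP => kn; last first.
  rewrite big1 // => l _; rewrite ltn_eqF ?mul0r //.
  by apply: leq_trans (ltn_ord l) _; rewrite leqNgt kn.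
rewrite -[RHS](sum_indicator (Ordinal kn) (fun l : 'I_n => g l)).
by apply: eq_bigr => l _; rewrite eq_sym.
Qed.

Definition before (g : nat -> R) (k : nat) : R := if k is k'.+1 then g k' else 0.

Lemma sum_ord_succ (n k : nat) (g : nat -> R) : (k <= n)%N ->
  \sum_(l < n) (k == l.+1 :> nat)%:R * g l = before g k.
Proof.
case: k => [|k] kn; first by rewrite big1 // => l _; rewrite mul0r.
under eq_bigr => l _ do rewrite eqSS eq_sym.
by rewrite sum_ord_eq kn.
Qed.

Variable n : nat.

(** Discrete Green function of the tridiagonal Gram matrix: [lgreen] solves the recurrence with
    value 0 at index -1, [rgreen] with value 0 at index [n], and dividing by [cheb n.+1] makes their
    Wronskian 1. *)
Definition lgreen j := cheb j.+1.
Definition rgreen j := cheb (n - j) / cheb n.+1.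
Definition loop_green l m := lgreen (minn l m) * rgreen (maxn l m).

Lemma rgreen_n : rgreen n = 0.
Proof. by rewrite /rgreen subnn mul0r. Qed.

Lemma rgreenSS j : (j.+1 < n)%N -> rgreen j.+2 = 8 * rgreen j.+1 - rgreen j.
Proof.
move=> h; rewrite /rgreen.
have -> : (n - j = (n - j.+2).+2)%N by lia.
have -> : (n - j.+1 = (n - j.+2).+1)%N by lia.
rewrite chebSS; ring.
Qed.

Lemma green_wronskian j : (j < n)%N ->
  lgreen j.+1 * rgreen j - lgreen j * rgreen j.+1 = 1.
Proof.
move=> h; rewrite /lgreen /rgreen !mulrA -mulrBl.
have -> : (n - j = (n - j.+1).+1)%N by lia.
rewrite chebD (_ : (j + (n - j.+1)).+2 = n.+1); last lia.
by rewrite divff // gt_eqF ?cheb_gt0.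
Qed.

(** Off the diagonal the recurrence of [lgreen] or [rgreen] gives 0; on the diagonal the mismatch
    between the two is the Wronskian. *)
Lemma loop_green_inv (m j : nat) : (m < n)%N -> (j < n)%N ->
  \sum_(l < n) loop_green m l *
     (8 * (l == j :> nat)%:R - (l == j.+1 :> nat)%:R - (j == l.+1 :> nat)%:R)
  = (m == j)%:R.
Proof.
move=> mn jn.
transitivity (8 * loop_green m j - loop_green m j.+1 - before (loop_green m) j).
  rewrite -(sum_ord_succ (loop_green m) (ltnW jn)).
  have -> : loop_green m j.+1 = \sum_(l < n) (l == j.+1 :> nat)%:R * loop_green m l.
    rewrite sum_ord_eq; case: ltnP => // nj.
    have -> : j.+1 = n by lia.
    by rewrite /loop_green (maxn_idPr (ltnW mn)) rgreen_n mulr0.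
  have -> : loop_green m j = \sum_(l < n) (l == j :> nat)%:R * loop_green m l.
    by rewrite sum_ord_eq jn.
  by rewrite mulr_sumr -!sumrB; apply: eq_bigr => l _; ring.
have beforeE : (j <= m)%N -> before (loop_green m) j = cheb j * rgreen m.
  case: j jn => [|j] jn jm; first by rewrite /cheb /= mul0r.
  by rewrite /before /loop_green (minn_idPr (ltnW jm)) (maxn_idPl (ltnW jm)).
case: (ltngtP m j) => [mj|jm|mj].
- case: j mj jn beforeE => // j mj jn _; rewrite /before /loop_green.
  rewrite !(minn_idPl _) ?(ltnW mj) //; try lia.
  rewrite !(maxn_idPr _) ?(ltnW mj) //; try lia.
  by rewrite rgreenSS //=; ring.
- rewrite (beforeE (ltnW jm)) /loop_green.
  rewrite !(minn_idPr _) ?(ltnW jm) // !(maxn_idPl _) ?(ltnW jm) //.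
  by rewrite /lgreen chebSS /=; ring.
subst j; rewrite beforeE // /loop_green minnn maxnn (minn_idPl (leqnSn m)) (maxn_idPr (leqnSn m)).
apply: etrans (green_wronskian mn); rewrite /lgreen chebSS; ring.
Qed.

Lemma sum_sym (F : nat -> nat -> R) k : (forall i j, F i j = F j i) ->
  \sum_(i < k) \sum_(j < k) F i j = \sum_(i < k) (F i i + 2 * \sum_(j < i) F j i).
Proof.
move=> Fs; elim: k => [|k IH]; first by rewrite !big_ord0.
rewrite !big_ord_recr /= -IH.
under eq_bigr => i _ do rewrite big_ord_recr /=.
rewrite big_split /= -!addrA; congr (_ + _).
under [X in _ + (X + _) = _]eq_bigr => j _ do rewrite Fs.
by ring.
Qed.

(** The number of vertices whose flow crosses octagon [j]: six for each octagon to its right. *)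
Definition right_count j : R := (6 * (n - j.+1))%:R.
Definition chain_order : R := (6 * n + 2)%:R.
(* [lweight 0 = 0] and [rweight n.-1 = 0]: terminal octagons have no weight. *)
Definition lweight j : R := (chain_order - right_count j) * lgreen j - lgreen j.+1.
Definition rweight j : R := right_count j * rgreen j + rgreen j.+1.
Definition weight i j : R := lweight (minn i j) * rweight (maxn i j).

Variables (x : nat -> R) (d : nat -> R).

(** [tot] and [moment] are the first and second moments of the circulations over all starts, see
    [sum_loop_flow] and [sum_moment]; [d] is the part of the diagonal free of [x]. *)
Let tot j := right_count j * x j + before x j.

Definition moment l m :=
  if l == m then right_count l * x l ^+ 2 + d l
  else x (minn l m) * tot (maxn l m)
       - (maxn l m == (minn l m).+1)%:R * ((x (minn l m) ^+ 2 + 9) / 2).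

Let lsum m := \sum_(l < m) lweight l * x l.

(** Summation by parts: shifting the index in the [before] part of [tot] turns [lgreen] into
    [lweight] and leaves a boundary term. *)
Let lsumE m :
  \sum_(l < m) lgreen l * (chain_order * x l - tot l) = lsum m + lgreen m * before x m.
Proof.
elim: m => [|m IH]; first by rewrite /lsum !big_ord0 mulr0 addr0.
by rewrite /lsum !big_ord_recr /= IH /tot /lweight /lsum; ring.
Qed.

Let covariance_row m : (m < n)%N ->
  \sum_(l < m) loop_green l m * (chain_order * moment l m - tot l * tot m) =
  rgreen m * tot m * (lsum m + lgreen m * before x m)
  - chain_order / 2 * rgreen m * (before lgreen m * (before x m ^+ 2 + 9)).
Proof.
move=> mn; rewrite -lsumE.
transitivity (\sum_(l < m) (rgreen m * tot m * (lgreen l * (chain_order * x l - tot l))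
   - chain_order / 2 * rgreen m * ((m == l.+1 :> nat)%:R * (lgreen l * (x l ^+ 2 + 9))))).
  apply: eq_bigr => l _; have lm := ltn_ord l.
  rewrite /moment /loop_green (ltn_eqF lm) (minn_idPl (ltnW lm)) (maxn_idPr (ltnW lm)).
  by field.
rewrite sumrB -!mulr_sumr; congr (_ - _ * _).
rewrite (sum_ord_succ (fun l => lgreen l * (x l ^+ 2 + 9)) (leqnn m)).
by case: (m) => [|k] //=; rewrite mul0r.
Qed.

(** Up to sign and constants, the left side is all that depends on the offsets in the Kirchhoff
    index. The right side brings it to a quadratic form whose coefficients have a visible sign. *)
Lemma weight_identity :
  \sum_(l < n) \sum_(m < n) loop_green l m * (chain_order * moment l m - tot l * tot m)
  - \sum_(l < n) right_count l * x l ^+ 2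
  = \sum_(l < n) \sum_(m < n) weight l m * (x l * x m)
  + \sum_(m < n) (chain_order * lgreen m * rgreen m * d m -
                  9 * chain_order * before lgreen m * rgreen m).
Proof.
have Gs i j : loop_green i j = loop_green j i by rewrite /loop_green minnC maxnC.
have Ms i j : moment i j = moment j i.
  by rewrite /moment eq_sym minnC maxnC; case: eqP => // ->.
have Ws i j : weight i j = weight j i by rewrite /weight minnC maxnC.
rewrite (sum_sym (F := fun l m => loop_green l m * (chain_order * moment l m - tot l * tot m)));
  last by move=> i j; rewrite Gs Ms [tot i * _]mulrC.
rewrite (sum_sym (F := fun l m => weight l m * (x l * x m)));
  last by move=> i j; rewrite Ws [x i * _]mulrC.
(* The last two terms are the boundary terms of a telescoping sum; they vanish
   at [k = n] since [rgreen n = 0]. *)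
suff IH k : (k <= n)%N ->
    \sum_(i < k) (loop_green i i * (chain_order * moment i i - tot i * tot i) +
      2 * \sum_(j < i) loop_green j i * (chain_order * moment j i - tot j * tot i))
    - \sum_(l < k) right_count l * x l ^+ 2
    = \sum_(i < k) (weight i i * (x i * x i) +
        2 * \sum_(j < i) weight j i * (x j * x i))
    + \sum_(m < k) (chain_order * lgreen m * rgreen m * d m -
                  9 * chain_order * before lgreen m * rgreen m)
    - 2 * lsum k * rgreen k * before x k
    - (lgreen k - chain_order * before lgreen k) * rgreen k * before x k ^+ 2.
  by rewrite IH // rgreen_n; ring.
elim: k => [|k IH] kn; first by rewrite !big_ord0 /=; ring.
rewrite ![\sum_(_ < k.+1) _]big_ord_recr /= covariance_row //.
have -> : \sum_(j < k) weight j k * (x j * x k) = rweight k * x k * lsum k.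
  rewrite /lsum mulr_sumr; apply: eq_bigr => l _; have lm := ltn_ord l.
  by rewrite /weight (minn_idPl (ltnW lm)) (maxn_idPr (ltnW lm)); ring.
move: {IH}(IH (ltnW kn)).
set L := \sum_(i < k) _; set Q := \sum_(i < k) _.
set W := \sum_(i < k) _; set D := \sum_(i < k) _ => IH.
have -> : lsum k.+1 = lsum k + lweight k * x k by rewrite /lsum big_ord_recr.
have {IH}-> : L = W + D + Q - 2 * lsum k * rgreen k * before x k
    - (lgreen k - chain_order * before lgreen k) * rgreen k * before x k ^+ 2.
  by rewrite -[L](subrK Q) IH; ring.
have wr := green_wronskian kn.
rewrite /moment eqxx /weight /loop_green minnn maxnn /lweight /rweight /tot.
apply/eqP; rewrite -subr_eq0; apply/eqP.
(* The two sides differ by a multiple of the Wronskian minus 1; the [- 1] comes from the subtracted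
   squares. *)
transitivity (right_count k * x k ^+ 2 * (lgreen k.+1 * rgreen k - lgreen k * rgreen k.+1 - 1));
  last by rewrite wr subrr mulr0.
by field.
Qed.
End LoopGreen.

(** * The Kirchhoff index of a chain *)

Section ChainKirchhoff.
Variables (R : realFieldType) (n : nat).

Lemma sum_coord (g : bool + 'I_n * 'I_6 -> R) :
  \sum_c g c = g (inl true) + g (inl false) + \sum_j \sum_s g (inr (j, s)).
Proof.
rewrite big_sumType /= big_bool pair_big /=; congr (_ + _).
by apply: eq_bigr => -[].
Qed.

Lemma sum_ord_gt (l : nat) (c : R) :
  \sum_(j < n) (l < j)%:R * (6 * c) = right_count R n l * c.
Proof.
rewrite -mulr_suml -natr_sum /right_count natrM.
have -> : (\sum_(j < n) (l < j) = n - l.+1)%N.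
  elim: n => [|m IH]; first by rewrite big_ord0.
  by rewrite big_ord_recr /= IH; case: ltnP; lia.
ring.
Qed.

Section Moments.
Variable t : 'I_n -> 'I_5.
Local Notation x := (offset R t).

(** [35 / 2] is the sum of [(s - 5/2)^2] over the six positions. The other term adds [1/4] for each
    of the six vertices of the previous octagon or, if [m = 0], for the two ends of the first
    rung. *)
Definition diag_moment (m : nat) : R := 35 / 2 + (if m == 0%N then 2^-1 else 3 / 2).

(** Over one octagon the values [s - 5/2] cancel, and the rung terms add up to the offset of the
    previous octagon. *)
Lemma sum_loop_flow (l : 'I_n) :
  \sum_c dot (flow R t c) (loop R t l) = right_count R n l * x l + before x l.
Proof.
rewrite sum_coord !loop_flow.
rewrite -sum_ord_gt -(sum_ord_succ x (ltnW (ltn_ord l))) -big_split /=.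
rewrite mulrN subrr add0r; apply: eq_bigr => j _.
under eq_bigr => s _ do rewrite loop_flow.
rewrite 2!big_split /= sumr_const card_ord -!mulr_sumr sum_exit_rung // -offsetE.
rewrite (_ : \sum_(s < 6) _ = 0); first by rewrite -mulr_natr; ring.
by rewrite !big_ord_recl big_ord0 /= /bump /=; field.
Qed.

Lemma moment_square (j l m : 'I_n) : (l < m)%N ->
  \sum_s dot (flow R t (inr (j, s))) (loop R t l) * dot (flow R t (inr (j, s))) (loop R t m) =
  (m < j)%:R * (6 * (x l * x m)) + (m == j.+1 :> nat)%:R *
     (x l * x j - (l == j :> nat)%:R * ((x l ^+ 2 + 9) / 2)).
Proof.
move=> lm; under eq_bigr => s _ do rewrite !loop_flow.
have [-> ->] : (l == j) = (l == j :> nat) /\ (m == j) = (m == j :> nat) by [].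
have [mj|jm|mj] := ltngtP m j.
- have [-> ->] : (l < j)%N /\ (l == j :> nat) = false by lia.
  have [-> ->] : (l == j.+1 :> nat) = false /\ (m == j.+1 :> nat) = false by lia.
  under eq_bigr => s _ do rewrite !mul1r !mul0r !addr0.
  by rewrite sumr_const card_ord -mulr_natl /=; ring.
- have [mj1|mj1] := eqVneq (m : nat) j.+1; last first.
    by rewrite big1 => [|s _] /=; ring.
  have -> : (l == j.+1 :> nat) = false by lia.
  transitivity (\sum_(s < 6) ((l < j)%:R * x l * (- exit_flow R s (t j).+1) +
    (l == j :> nat)%:R * ((s%:R - 5 / 2) * - exit_flow R s (t j).+1))).
    by apply: eq_bigr => s _ /=; ring.
  rewrite big_split /= -!mulr_sumr sum_exit_rung // sum_exit_rung_pos // -offsetE.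
  have := lm; rewrite mj1 ltnS leq_eqVlt.
  by case: (ltngtP l j) => // [lj|lj] _; rewrite ?lj /=; field.
have -> : (l == j.+1 :> nat) = false by lia.
have -> : (m == j.+1 :> nat) = false by lia.
have [-> ->] : (l < j)%N /\ (l == j :> nat) = false by lia.
transitivity (x l * \sum_(s < 6) (s%:R - 5 / 2)).
  by rewrite mulr_sumr; apply: eq_bigr => s _ /=; ring.
by rewrite !big_ord_recl big_ord0 /= /bump /=; field.
Qed.

Lemma moment_square_diag (j m : 'I_n) :
  \sum_s dot (flow R t (inr (j, s))) (loop R t m) ^+ 2 =
  (m < j)%:R * (6 * (x m ^+ 2)) + (m == j)%:R * (35 / 2)
  + (m == j.+1 :> nat)%:R * (3 / 2).
Proof.
under eq_bigr => s _ do rewrite !loop_flow.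
have -> : (m == j) = (m == j :> nat) by [].
have [mj|jm|mj] := ltngtP m j.
- have -> : (m == j.+1 :> nat) = false by lia.
  transitivity (\sum_(s < 6) x m ^+ 2); first by apply: eq_bigr => s _ /=; ring.
  by rewrite sumr_const card_ord -mulr_natl /=; ring.
- transitivity (\sum_(s < 6) (m == j.+1 :> nat)%:R * exit_flow R s (t j).+1 ^+ 2).
    by apply: eq_bigr => s _ /=; case: eqP => _ /=; ring.
  rewrite -mulr_sumr (_ : \sum_(s < 6) _ = 3 / 2); first by rewrite /=; ring.
  transitivity (\sum_(s < 6) (2^-1 ^+ 2 : R)).
    by apply: eq_bigr => s _; rewrite /exit_flow; case: ifP => _; ring.
  by rewrite sumr_const card_ord -mulr_natl; field.
have -> : (m == j.+1 :> nat) = false by lia.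
transitivity (\sum_(s < 6) (s%:R - 5 / 2 : R) ^+ 2).
  by apply: eq_bigr => s _ /=; ring.
by rewrite !big_ord_recl big_ord0 /= /bump /=; field.
Qed.

Lemma sum_moment (l m : 'I_n) :
  \sum_c dot (flow R t c) (loop R t l) * dot (flow R t c) (loop R t m) =
  moment n x diag_moment l m.
Proof.
wlog lm : l m / (l <= m)%N => [H|].
  case: (leqP l m) => [/H //|/ltnW/H E].
  rewrite /moment eq_sym minnC maxnC -/(moment n x diag_moment m l).
  transitivity (moment n x diag_moment m l).
    by rewrite -E; apply: eq_bigr => c _; rewrite mulrC.
  by rewrite /moment; case: eqP => // ->.
rewrite sum_coord !loop_flow /moment.
move: lm; rewrite leq_eqVlt => /orP[/eqP lm|lm].
  have -> : l = m by apply: val_inj.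
  rewrite eqxx; under eq_bigr => j _ do under eq_bigr => s _ do rewrite -expr2.
  under eq_bigr => j _ do rewrite moment_square_diag.
  rewrite 2!big_split /= sum_ord_gt (sum_indicator m (fun=> 35 / 2)).
  rewrite (sum_ord_succ (fun=> 3 / 2) (ltnW (ltn_ord m))) /diag_moment.
  by case: (nat_of_ord m) => [|k] /=; field.
rewrite (ltn_eqF lm) (minn_idPl (ltnW lm)) (maxn_idPr (ltnW lm)).
under eq_bigr => j _ do rewrite moment_square //.
rewrite big_split /= sum_ord_gt.
rewrite (sum_ord_succ (fun j => x l * x j - (l == j :> nat)%:R * ((x l ^+ 2 + 9) / 2))
  (ltnW (ltn_ord m))).
case: (nat_of_ord m) lm => [//|k] lm /=; rewrite eqSS [k == _]eq_sym; ring.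
Qed.

Lemma sum_flow (j : 'I_n) (k : 'I_7) :
  \sum_c flow R t c (Some (j, k)) = (3 - k%:R) + right_count R n j * thru R (t j) k.
Proof.
rewrite sum_coord /= !add0r -sum_ord_gt -(sum_exits R (ltn_ord k)).
rewrite -(sum_indicator j (fun=> \sum_(s < 6) exit_flow R s k)) -big_split /=.
apply: eq_bigr => i _.
have -> : (j == i) = (j == i :> nat) by [].
case: (ltngtP j i) => ji /=; rewrite ?mul0r ?mul1r ?add0r ?addr0 //.
  by rewrite sumr_const card_ord mulr_natl.
by rewrite big1.
Qed.

(** Only the cross term of [thru] with the exit flows depends on the chain; its [x j ^+ 2] is
    absorbed by [weight_identity]. On the first rung the flows from its two ends cancel. *)
Lemma sum_flow_sqr :
  \sum_e (\sum_c flow R t c e) ^+ 2 =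
  \sum_(j < n) (28 + right_count R n j * (12 - x j ^+ 2) + 3 / 2 * right_count R n j ^+ 2).
Proof.
rewrite sum_edge sum_coord /= addNr add0r.
rewrite [X in X ^+ 2 + _]big1 => [|j _]; last by rewrite big1.
rewrite expr0n /= add0r; apply: eq_bigr => j _.
under eq_bigr => k _ do rewrite sum_flow.
transitivity (\sum_(k < 7) ((3 - k%:R) ^+ 2 : R)
   + 2 * right_count R n j * \sum_(k < 7) thru R (t j) k * (3 - k%:R)
   + right_count R n j ^+ 2 * \sum_(k < 7) thru R (t j) k ^+ 2).
  by rewrite !mulr_sumr -!big_split /=; apply: eq_bigr => k _; ring.
rewrite sum_thru_exit // sum_thru_sqr // offsetE (_ : \sum_(k < 7) _ = 28).
  by field.
by rewrite !big_ord_recl big_ord0 /= /bump /=; ring.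
Qed.

End Moments.

Lemma Kirchhoff_chain : (0 < n)%N -> exists c : R, forall t : 'I_n -> 'I_5,
  Kirchhoff_index R (chain t) =
  c - \sum_(i < n) \sum_(j < n) weight R n i j * (offset R t i * offset R t j).
Proof.
move=> n0.
(* The constant collects the flow norms and the offset-free parts of [sum_flow_sqr] and
   [weight_identity]. *)
exists (chain_order R n * (\sum_(c : bool + 'I_n * 'I_6)
      if c is inr (j, _) then 3 / 2 * j%:R + 7 / 4 else 4^-1)
  - \sum_(j < n) (28 + right_count R n j * 12 + 3 / 2 * right_count R n j ^+ 2)
  - \sum_(m < n) (chain_order R n * lgreen R m * rgreen R n m * diag_moment m -
                  9 * chain_order R n * before (lgreen R) m * rgreen R n m)) => t.
pose p : {ffun chain t -> R} := [ffun v => if coord t v is inl _ then 2^-1 else 0].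
have fdiv u (phi : chain t -> R) :
    \sum_e flow R t (coord t u) e * (phi (edge_tl t e) - phi (edge_hd t e))
    = phi u - \sum_(v : chain t) p v * phi v.
  rewrite flow_div coordK; congr (_ - _).
  rewrite (sum_of_coord t) sum_coord [X in _ = _ + X]big1 => [|j _].
    by rewrite addr0 !ffunE !of_coordK -mulrDr.
  by rewrite big1 // => s _; rewrite ffunE of_coordK mul0r.
have ginv (m j : 'I_n) : \sum_(l < n) loop_green R n m l * dot (loop R t l) (loop R t j)
    = (m == j)%:R.
  apply: etrans (loop_green_inv R (ltn_ord m) (ltn_ord j)).
  by apply: eq_bigr => l _; rewrite loop_gram.
rewrite (@Kirchhoff_index_flow R (chain t) _ _ _
  (fun x y => chain_adjE t x y n0) (@edge_ends_inj _ t)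
  _ _ _ _ _ _ fdiv (@loop_div R n t) (@flow_diff R n t) ginv (@chain_connected n t)).
have by_coord (g : bool + 'I_n * 'I_6 -> R) :
    \sum_(v : chain t) g (coord t v) = \sum_c g c.
  by rewrite (sum_of_coord t); apply: eq_bigr => c _; rewrite of_coordK.
rewrite card_chain -/(chain_order R n).
rewrite (by_coord (fun c => dot (flow R t c) (flow R t c))).
under eq_bigr => c _ do rewrite flow_norm.
under [X in _ - X - _]eq_bigr => e _ do rewrite (by_coord (fun c => flow R t c e)).
rewrite sum_flow_sqr.
under [X in _ - X = _]eq_bigr => m _ do under eq_bigr => l _ do
  rewrite (by_coord (fun c => dot (flow R t c) (loop R t m) * dot (flow R t c) (loop R t l)))
    (by_coord (fun c => dot (flow R t c) (loop R t m)))
    (by_coord (fun c => dot (flow R t c) (loop R t l)))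
    sum_moment !sum_loop_flow.
have := weight_identity n (offset R t) diag_moment.
set Q := \sum_(l < n) \sum_(m < n) loop_green R n l m * _ => /eqP.
rewrite subr_eq => /eqP ->.
have -> : \sum_(j < n) (28 + right_count R n j * (12 - offset R t j ^+ 2)
      + 3 / 2 * right_count R n j ^+ 2)
  = \sum_(j < n) (28 + right_count R n j * 12 + 3 / 2 * right_count R n j ^+ 2)
  - \sum_(l < n) right_count R n l * offset R t l ^+ 2.
  by rewrite -sumrB; apply: eq_bigr => j _; ring.
ring.
Qed.
End ChainKirchhoff.

(** * Reflecting the octagons *)

Section Reflection.
Local Open Scope nat_scope.

Definition refl8 (c s : nat) : nat := (c + 8 - s) %% 8.

Definition reflect_chain (n : nat) (n0 : 0 < n) (c : 'I_n -> nat)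
    (t t' : 'I_n -> 'I_5) (x : chain_vertex n) : chain_vertex n :=
  match coord t x with
  | inl b => oct t' (Ordinal n0) (refl8 (c (Ordinal n0)) (if b then 0 else 7))
  | inr (j, s) => oct t' j (refl8 (c j) s.+1)
  end.

(* Reflecting octagon [i] by [s |-> c_i - s] mod 8 must exchange the ends of its
   right rung, at positions [t i + 1], [t i + 2] and [t' i + 1], [t' i + 2], as well
   as those of its left rung, at 0 and 7, except for the first octagon. *)
Definition compatible (n : nat) (c : 'I_n -> nat) (t t' : 'I_n -> 'I_5) :=
  forall j : 'I_n, c j < 8 /\ (0 < j -> c j = 7)
    /\ (j.+1 < n -> c j = (t j + t' j + 3) %% 8).

Lemma compatible_sym n (c : 'I_n -> nat) t t' : compatible c t t' -> compatible c t' t.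
Proof. by move=> ct j; rewrite [t' j + _]addnC; apply: ct. Qed.

(** The ends of a left rung are mapped by the reflection of the previous octagon; compatibility
    makes it agree there with the reflection of octagon [j]. *)
Lemma reflect_oct n (n0 : 0 < n) (c : 'I_n -> nat) (t t' : 'I_n -> 'I_5)
    (j : 'I_n) (s : nat) : compatible c t t' -> s <= 8 ->
  reflect_chain n0 c t t' (oct t j s) = oct t' j (refl8 (c j) s).
Proof.
move=> ct s8.
have rung b : reflect_chain n0 c t t' (oct t j (if b then 0 else 7)) =
    oct t' j (refl8 (c j) (if b then 0 else 7)).
  have [/= cj8 [cj7 _]] := ct j.
  case: (left_rungP t j) => [j0|i ji E0 E7].
    have -> : j = Ordinal n0 by apply: val_inj.
    have E := oct_start t (j := Ordinal n0) erefl.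
    by case: b; rewrite E /reflect_chain /coord unlift_none.
  case: (left_rungP t' j) => [|i' ji' E0' E7']; first by rewrite ji.
  have ii : i' = i by apply: val_inj; move: ji'; rewrite ji => -[].
  rewrite ii in E0' E7'.
  have ti := ltn_ord (t i); have ti' := ltn_ord (t' i).
  have i0 : t i < 6 by lia.
  have i1 : (t i).+1 < 6 by lia.
  have [ci8 [_ ci]] := ct i.
  have {}ci : c i = (t i + t' i + 3) %% 8 by apply: ci; rewrite -ji.
  rewrite cj7; last by rewrite ji.
  case: b.
    rewrite E0 /reflect_chain (coord_oct t i (Ordinal i0)) /= [refl8 7 0]/=.
    by rewrite E7' ci /refl8; congr oct; lia.
  rewrite E7 /reflect_chain (coord_oct t i (Ordinal i1)) /= [refl8 7 7]/=.
  by rewrite E0' ci /refl8; congr oct; lia.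
case: (posnP s) => [->|s0]; first exact: (rung true).
have [->|s7] := eqVneq s 7; first exact: (rung false).
have [->|s8'] := eqVneq s 8.
  rewrite -[oct t j 8]/(oct t j 0) (rung true) /refl8; congr oct; lia.
have s6 : s.-1 < 6 by lia.
rewrite -{1}[s]prednK // /reflect_chain (coord_oct t j (Ordinal s6)) /=.
by rewrite prednK.
Qed.

Lemma vertex_oct n (n0 : 0 < n) (t : 'I_n -> 'I_5) x :
  exists j s, s < 8 /\ x = oct t j s.
Proof.
rewrite -(coordK t x); case: (coord t x) => [b|[j s]] /=.
  by exists (Ordinal n0), (if b then 0 else 7); case: b; split;
    rewrite ?(@oct_start _ t (Ordinal n0)).
by exists j, s.+1; split => //; have := ltn_ord s; lia.
Qed.

Lemma reflect_chainK n (n0 : 0 < n) (c : 'I_n -> nat) (t t' : 'I_n -> 'I_5) :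
  compatible c t t' -> cancel (reflect_chain n0 c t t') (reflect_chain n0 c t' t).
Proof.
move=> ct x; have [j [s [s8 ->]]] := vertex_oct n0 t x.
rewrite reflect_oct //; last exact: ltnW.
rewrite reflect_oct; [|exact: compatible_sym|by rewrite /refl8; lia].
by have [c8 _] := ct j; congr oct; rewrite /refl8; lia.
Qed.

Lemma reflect_chain_adj n (n0 : 0 < n) (c : 'I_n -> nat) (t t' : 'I_n -> 'I_5) x y :
  compatible c t t' -> chain_adj t x y ->
  chain_adj t' (reflect_chain n0 c t t' x) (reflect_chain n0 c t t' y).
Proof.
move=> ct /(chain_adj_octP _ _ _ n0)[j [s [s8 xy]]].
apply/(chain_adj_octP _ _ _ n0); exists j, (refl8 (c j) s.+1).
split; first by rewrite /refl8; lia.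
(* The reflected edge is traversed backwards; positions 0 and 8 name the same vertex, which settles
   the wrap-around modulo 8. *)
have -> : oct t' j (refl8 (c j) s.+1).+1 = oct t' j (refl8 (c j) s).
  have [c8 _] := ct j.
  have [r|r] : (refl8 (c j) s.+1).+1 = 8 /\ refl8 (c j) s = 0
            \/ (refl8 (c j) s.+1).+1 = refl8 (c j) s by rewrite /refl8; lia.
    by case: r => -> ->.
  by rewrite r.
by case: xy => -[-> ->]; rewrite !reflect_oct //; try lia; [right|left].
Qed.

Lemma reflect_isomorphic n (n0 : 0 < n) (c : 'I_n -> nat) (t t' : 'I_n -> 'I_5) :
  compatible c t t' -> isomorphic (chain t) (chain t').
Proof.
move=> ct; have ct' := compatible_sym ct.
exists (reflect_chain n0 c t t').
  by exists (reflect_chain n0 c t' t); apply: reflect_chainK.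
move=> x y; apply/idP/idP; last exact: reflect_chain_adj.
move/(reflect_chain_adj n0 ct'); rewrite !(reflect_chainK n0 ct) //.
Qed.

End Reflection.

(** * Positivity of the weights *)

Section Weights.
Variables (R : realFieldType) (n : nat).

Lemma lweightE j : (j < n)%N -> lweight R n j = 6 * j%:R * cheb R j.+1 + cheb R j.
Proof.
move=> jn; rewrite /lweight /chain_order /right_count /lgreen chebSS.
have -> : (6 * n + 2 = 6 * (n - j.+1) + (6 * j + 8))%N by lia.
rewrite (natrD _ (6 * (n - j.+1))) (natrD _ (6 * j) 8) (natrM _ 6 j); ring.
Qed.

Lemma lweight_ge0 j : (j < n)%N -> 0 <= lweight R n j.
Proof.
move=> jn; rewrite lweightE // addr_ge0 ?mulr_ge0 ?ler0n //.
  exact/ltW/cheb_gt0.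
by have /andP[] := cheb_lt R j.
Qed.

Lemma lweight_gt0 j : (0 < j < n)%N -> 0 < lweight R n j.
Proof.
move=> /andP[j0 jn]; rewrite lweightE // ltr_wpDr //.
  by have /andP[] := cheb_lt R j.
by rewrite !mulr_gt0 ?ltr0n // cheb_gt0.
Qed.

Lemma rgreen_ge0 j : 0 <= rgreen R n j.
Proof.
by rewrite divr_ge0 ?(ltW (cheb_gt0 _ _)) //; have /andP[] := cheb_lt R (n - j).
Qed.

Lemma rweight_ge0 j : 0 <= rweight R n j.
Proof. by apply: addr_ge0; [apply: mulr_ge0; [apply: ler0n|]|]; apply: rgreen_ge0. Qed.

Lemma rweight_gt0 j : (j.+1 < n)%N -> 0 < rweight R n j.
Proof.
move=> jn; rewrite ltr_wpDr ?rgreen_ge0 // mulr_gt0 //; first by rewrite /right_count ltr0n; lia.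
rewrite divr_gt0 ?cheb_gt0 //.
by rewrite (_ : (n - j = (n - j.+1).+1)%N) ?cheb_gt0 //; lia.
Qed.

Lemma weight_ge0 i j : (i < n)%N -> 0 <= weight R n i j.
Proof. by move=> ni; rewrite mulr_ge0 ?rweight_ge0 ?lweight_ge0 // gtn_min ni. Qed.

Lemma weight_gt0 i j : (0 < i)%N -> (i.+1 < n)%N -> (0 < j)%N -> (j.+1 < n)%N ->
  0 < weight R n i j.
Proof.
move=> i0 ni j0 nj; rewrite mulr_gt0 ?lweight_gt0 ?rweight_gt0 //; last by lia.
by lia.
Qed.

End Weights.

(** * The minimum and its equality case *)

Lemma offset_prod_le (R : realFieldType) n (t : 'I_n -> 'I_5) (i j : nat) :
  offset R t i * offset R t j <= 4.
Proof.
have bnd k : -2 <= offset R t k <= 2.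
  rewrite /offset; case: insubP => [l _ _|_]; last by apply/andP; split; lra.
  have : (t l)%:R <= 4%:R :> R by rewrite ler_nat -ltnS.
  have : 0 <= (t l)%:R :> R by rewrite ler0n.
  by move=> h0 h4; apply/andP; split; lra.
by have /andP[a b] := bnd i; have /andP[c d] := bnd j; nra.
Qed.

Lemma Kirchhoff_chain_min (R : realFieldType) (n : nat) (t t0 : 'I_n -> 'I_5) :
  (0 < n)%N -> (forall j, t0 j = ord0) ->
  Kirchhoff_index R (chain t0) <= Kirchhoff_index R (chain t)
  /\ (Kirchhoff_index R (chain t) = Kirchhoff_index R (chain t0) ->
      forall i j : 'I_n, (0 < i)%N -> (i.+1 < n)%N -> (0 < j)%N -> (j.+1 < n)%N ->
      offset R t i * offset R t j = 4).
Proof.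
move=> n0 t00; have [c KE] := Kirchhoff_chain R n0.
(* All offsets of [t0] are -2, so each of its products is 4, the largest possible value. *)
have gap : Kirchhoff_index R (chain t) - Kirchhoff_index R (chain t0) =
    \sum_(i < n) \sum_(j < n) weight R n i j * (4 - offset R t i * offset R t j).
  rewrite !KE opprB addrC addrA subrK -sumrB; apply: eq_bigr => i _.
  rewrite -sumrB; apply: eq_bigr => j _.
  by rewrite !(offsetE R t0) !t00 /=; ring.
have term_ge0 (i j : 'I_n) : 0 <= weight R n i j * (4 - offset R t i * offset R t j).
  by rewrite mulr_ge0 ?weight_ge0 // subr_ge0 offset_prod_le.
split=> [|KK i j i0 ni j0 nj].
  by rewrite -subr_ge0 gap !sumr_ge0 // => i _; rewrite sumr_ge0.
move/eqP: gap; rewrite KK subrr eq_sym => /eqP.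
move/psumr_eq0P => /(_ _ i isT) h; move: (h (fun k _ => sumr_ge0 _ (fun l _ => term_ge0 k l))).
move/psumr_eq0P => /(_ (fun l _ => term_ge0 i l) j isT) /eqP.
rewrite mulf_eq0 (gt_eqF (weight_gt0 R i0 ni j0 nj)) /= subr_eq0 => /eqP <- //.
Qed.

Lemma eq_chain_adj (n : nat) (t t' : 'I_n -> 'I_5) : t =1 t' ->
  forall x y, chain_adj t x y = chain_adj t' x y.
Proof.
move=> E; suff step x y : chain_step t x y = chain_step t' x y.
  by move=> x y; rewrite /chain_adj !step.
rewrite /chain_step; congr (_ || _); apply: eq_existsb => j.
by apply: eq_existsb => b; rewrite /side_path E.
Qed.

Lemma offset_prod_eq4 (R : realFieldType) (u v : 'I_5) :
  (u%:R - 2) * (v%:R - 2) = 4 :> R ->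
  u = 0%N :> nat /\ v = 0%N :> nat \/ u = 4%N :> nat /\ v = 4%N :> nat.
Proof.
move=> h; have : (((u : nat)%:Z - 2) * ((v : nat)%:Z - 2))%:~R == (4 : int)%:~R :> R.
  by rewrite intrM !intrB h.
rewrite eqr_int {h}; case: u v => -[|[|[|[|[|//]]]]] _ [] [|[|[|[|[|//]]]]] _ //=; tauto.
Qed.

Lemma Kirchhoff_chain_unique_min (R : realFieldType) (n : nat) (t t0 : 'I_n -> 'I_5) :
  (1 < n)%N -> (forall j, t0 j = ord0) ->
  (forall j : 'I_n, (j == 0%N :> nat) || (j.+1 == n) -> t j = ord0) ->
  Kirchhoff_index R (chain t0) <= Kirchhoff_index R (chain t)
  /\ (Kirchhoff_index R (chain t) = Kirchhoff_index R (chain t0) ->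
      isomorphic (chain t) (chain t0)).
Proof.
move=> hn t00 t_end; have n0 : (0 < n)%N by apply: ltnW.
have [le_t eq_t] := Kirchhoff_chain_min R t n0 t00; split; first exact: le_t.
move=> /eq_t {}eq_t.
have [v v04 tv] : exists2 v : nat, (v = 0%N) \/ (v = 4%N) &
    forall j : 'I_n, (0 < j)%N -> (j.+1 < n)%N -> t j = v :> nat.
  (* For [n = 2] there is no inner octagon; otherwise each inner octagon is compared with octagon
     1. *)
  case: (ltnP 2 n) => n2; last by exists 0%N => [|j j0 jn]; [left|lia].
  pose j1 : 'I_n := Ordinal hn; exists (t j1).
    by have := eq_t j1 j1 isT n2 isT n2; rewrite !offsetE => /offset_prod_eq4; tauto.
  move=> j j0 jn; have := eq_t j1 j isT n2 j0 jn.
  by rewrite !offsetE => /offset_prod_eq4[] [-> ->].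
case: v04 => v04.
  suff tE : t =1 t0.
    exists id; first by exists id.
    by move=> x y; rewrite /= (eq_chain_adj tE).
  move=> j; rewrite t00; case: (posnP j) => [j0|j0]; first by rewrite t_end ?j0.
  case: (ltnP j.+1 n) => jn; first by apply: val_inj; rewrite /= tv.
  by apply: t_end; have := ltn_ord j; lia.
(* The right rungs ask for [t j + t0 j + 3], which is 3 in the first octagon and [4 + 0 + 3 = 7] in
   the inner ones. The last octagon only has to match its left rung, which asks for 7. *)
apply: (reflect_isomorphic n0 (c := fun j => if j == 0%N :> nat then 3 else 7)).
move=> j; rewrite t00; split; first by case: eqP.
split=> [/gtn_eqF-> //|jn].
case: (posnP j) => [j0|j0]; first by rewrite t_end ?j0.
by rewrite tv // v04.
Qed.

Unset Implicit Arguments.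

Theorem theorem2 (R : realFieldType) (n : nat) (hn : (2 <= n)%N)
    (w : n.-2.-tuple 'I_5) :
  Kirchhoff_index R (helicene n) <= Kirchhoff_index R (octagonal_chain w)
  /\ (Kirchhoff_index R (octagonal_chain w) = Kirchhoff_index R (helicene n) ->
      isomorphic (octagonal_chain w) (helicene n)).
Proof.
apply: (Kirchhoff_chain_unique_min R hn) => j.
  set s := _ :: _; have /all_nthP s0 : all (pred1 ord0) s.
    by rewrite /s /= all_rcons /= all_map; apply/allP.
  case: (ltnP j (size s)) => js; first exact/eqP/s0.
  by rewrite nth_default.
case/orP=> [/eqP-> //|]; case: (nat_of_ord j) => [//|k] /= kn.
rewrite nth_rcons size_tuple; case: ltnP => [|_]; first by lia.
by case: ifP.
Qed.
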